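(* The top factor $M(0)=L(0)/L(1)$ of the series $L=L(0)\supseteq L(1)\supseteq L(2)\supseteq\cdots$ is always an irreducible $KG$-module.
   Context: Let $n\ge 2$ and $G=\mathrm{GL}_n(q)$, the general linear group over the finite field $F_q$ of characteristic $p$. Let $\ell\ne p$ be a prime, and let $R$ be a local principal ideal domain of characteristic $0$ with maximal ideal $\ell R$, containing a primitive $p$-th root of unity; $K=R/\ell R$. Modules are left modules. $B$ is the group of upper triangular matrices in $G$; $S_n$ is viewed as the subgroup of permutation matrices of $G$; $\widehat{S}=\sum_{s\in S}s\in RG$ for $S\subseteq G$. Put $\varepsilon=\sum_{\sigma\in S_n}\mathrm{sg}(\sigma)\,\sigma\widehat{B}\in RG$. The Steinberg lattice is the left ideal $I=RG\cdot\varepsilon$, and $L=I/\ell I$, a $KG$-module. Let $f:I\times I\to R$ be the restriction to $I$ of the $R$-bilinear form on $RG$ given by $(g,h)\mapsto\delta_{g,h}$ for $g,h\in G$, scaled by $1/|B|$ (it takes values in $R$). For $c\ge 0$ put $I(c)=\{x\in I : f(x,I)\subseteq \ell^cR\}$ and $L(c)=(I(c)+\ell I)/\ell I$. *)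

(* Defs.v *)
From HB Require Import structures.
From mathcomp Require Import all_boot all_order all_fingroup all_algebra.
From mathcomp Require Import boolp.

Set Implicit Arguments.
Unset Strict Implicit.
Unset Printing Implicit Defensive.

Import GRing.Theory generic_quotient.
Local Open Scope ring_scope.
Local Open Scope quotient_scope.

Definition ideal (R : comNzRingType) (J : R -> Prop) : Prop :=
  [/\ J 0, forall x y, J x -> J y -> J (x + y) & forall a x, J x -> J (a * x)].

Definition pid (R : idomainType) : Prop :=
  forall J : R -> Prop, ideal J -> exists a, forall x, J x <-> exists r, x = r * a.

Definition maximal_ideal (R : comNzRingType) (J : R -> Prop) : Prop :=
  [/\ ideal J, ~ J 1 &
      forall J' : R -> Prop, ideal J' -> (forall x, J x -> J' x) ->
        J' 1 \/ forall x, J' x -> J x].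

Definition local_with_maximal_ideal (R : comNzRingType) (J : R -> Prop) : Prop :=
  maximal_ideal J /\
  forall J' : R -> Prop, maximal_ideal J' -> forall x, J' x <-> J x.

Section SubmoduleType.
Variables (A : pzRingType) (V : lmodType A) (S : submodClosed V).

Record submodule_type := Submodule { submodule_val : V; _ : submodule_val \in S }.

HB.instance Definition _ := [isSub for submodule_val].
HB.instance Definition _ := [Choice of submodule_type by <:].
HB.instance Definition _ := [SubChoice_isSubLmodule of submodule_type by <:].

End SubmoduleType.

Section QuotientModule.
Variables (A : pzRingType) (V : lmodType A) (S : submodClosed V).

(* [submodClosed] does not inherit closure under opposites, which the quotient
   construction requires. *)
Definition submodule_pred : {pred V} := fun v => v \in S.

Fact submodule_pred_closed : zmod_closed submodule_pred.
Proof. exact: (GRing.submod_closedB (GRing.submodClosedP S)). Qed.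
HB.instance Definition _ := GRing.isZmodClosed.Build V submodule_pred
  submodule_pred_closed.

Definition quotient_module := Quotient.quot submodule_pred.

HB.instance Definition _ := GRing.Zmodule.on quotient_module.

Local Notation pi := (\pi_(Quotient.quot submodule_pred)).

Definition quotient_scale (a : A) (x : quotient_module) : quotient_module :=
  pi (a *: repr x).

Lemma quotient_reprK (x : quotient_module) : pi (repr x) = x.
Proof. exact: reprK. Qed.

Lemma quotient_piD u v : pi (u + v) = pi u + pi v :> quotient_module.
Proof. exact: raddfD. Qed.

Lemma quotient_piZ a v : quotient_scale a (pi v) = pi (a *: v).
Proof.
apply/eqP; rewrite /quotient_scale -Quotient.idealrBE -scalerBr.
have: repr (pi v) - v \in submodule_pred by rewrite Quotient.idealrBE reprK.
exact: rpredZ.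
Qed.

Fact quotient_scaleA a b x :
  quotient_scale a (quotient_scale b x) = quotient_scale (a * b) x.
Proof. by rewrite -[x]quotient_reprK !quotient_piZ scalerA. Qed.
Fact quotient_scale1 : left_id 1 quotient_scale.
Proof. by move=> x; rewrite -[x]quotient_reprK quotient_piZ scale1r. Qed.
Fact quotient_scaleDr : right_distributive quotient_scale +%R.
Proof.
move=> a x y; rewrite -[x]quotient_reprK -[y]quotient_reprK -quotient_piD !quotient_piZ.
by rewrite -quotient_piD scalerDr.
Qed.
Fact quotient_scaleDl x : {morph quotient_scale^~ x : a b / a + b}.
Proof. by move=> a b; rewrite -[x]quotient_reprK !quotient_piZ -quotient_piD scalerDl. Qed.

HB.instance Definition _ := GRing.Zmodule_isLmodule.Build A quotient_module
  quotient_scaleA quotient_scale1 quotient_scaleDr quotient_scaleDl.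

End QuotientModule.

Definition irreducible_module (A : pzRingType) (M : lmodType A) : Prop :=
  (exists x : M, x != 0) /\
  forall S : submodClosed M, (forall x, x \in S -> x = 0) \/ (forall x, x \in S).

Section Multiples.
Variables (V : zmodType) (l : nat).

Definition multiples : {pred V} := fun v => `[< exists w, v = w *+ l >].

Lemma multiplesP v : reflect (exists w, v = w *+ l) (v \in multiples).
Proof. exact: asboolP. Qed.

Fact multiples_zmod_closed : zmod_closed multiples.
Proof.
split=> [|x y /multiplesP[u ->] /multiplesP[v ->]]; apply/multiplesP.
  by exists 0; rewrite mul0rn.
by exists (u - v); rewrite mulrnBl.
Qed.
HB.instance Definition _ := GRing.isZmodClosed.Build V multiples
  multiples_zmod_closed.

End Multiples.
Arguments multiples : clear implicits.

(* The ring may be trivial here, so no hypothesis on [l] is needed. *)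
Section ResidueRing.
Variables (R : comPzRingType) (l : nat).

Definition residue_ring := Quotient.quot (multiples R l).

HB.instance Definition _ := GRing.Zmodule.on residue_ring.

Local Notation pi := (\pi_(Quotient.quot (multiples R l))).

Definition residue_one : residue_ring := pi 1.
Definition residue_mul (x y : residue_ring) : residue_ring := pi (repr x * repr y).

Lemma residue_reprK (x : residue_ring) : pi (repr x) = x.
Proof. exact: reprK. Qed.

Lemma residue_piD u v : pi (u + v) = pi u + pi v :> residue_ring.
Proof. exact: raddfD. Qed.

Lemma residue_piM a b : residue_mul (pi a) (pi b) = pi (a * b).
Proof.
have eq_pi c : exists d, repr (pi c) = c + d *+ l.
  have /multiplesP[d Ed] : repr (pi c) - c \in multiples R l.
    by rewrite Quotient.idealrBE reprK.
  by exists d; rewrite -Ed addrC subrK.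
apply/eqP; rewrite /residue_mul -Quotient.idealrBE.
have [c ->] := eq_pi a; have [d ->] := eq_pi b.
apply/multiplesP; exists (a * d + c * (b + d *+ l)).
rewrite [X in X - _]mulrDl [X in X + _ - _]mulrDr addrAC [X in X + _]addrAC.
by rewrite subrr add0r mulrnDl mulrnAr mulrnAl.
Qed.

Fact residue_mulA : associative residue_mul.
Proof.
by move=> x y z; rewrite -[x]residue_reprK -[y]residue_reprK -[z]residue_reprK !residue_piM mulrA.
Qed.
Fact residue_mulC : commutative residue_mul.
Proof. by move=> x y; rewrite -[x]residue_reprK -[y]residue_reprK !residue_piM mulrC. Qed.
Fact residue_mul1 : left_id residue_one residue_mul.
Proof. by move=> x; rewrite -[x]residue_reprK residue_piM mul1r. Qed.
Fact residue_mulDl : left_distributive residue_mul +%R.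
Proof.
move=> x y z; rewrite -[x]residue_reprK -[y]residue_reprK -[z]residue_reprK -residue_piD !residue_piM.
by rewrite -residue_piD mulrDl.
Qed.

HB.instance Definition _ := GRing.Zmodule_isComPzRing.Build residue_ring
  residue_mulA residue_mulC residue_mul1 residue_mulDl.

End ResidueRing.

(* This is an alias, because the library's own product on [{ffun gT -> R}]
   is pointwise; [[ffun g => E] * x] therefore needs a type annotation. *)
Section GroupAlgebra.
Variables (R : comPzRingType) (gT : finGroupType).

Definition group_algebra : Type := {ffun gT -> R}.

HB.instance Definition _ := GRing.Zmodule.copy group_algebra {ffun gT -> R}.

Implicit Types x y z : group_algebra.

Definition galg_elt (g : gT) : group_algebra := [ffun h => (h == g)%:R].

Definition galg_sum (S : {set gT}) : group_algebra := \sum_(g in S) galg_elt g.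

Definition galg_mul x y : group_algebra :=
  [ffun g => \sum_h x h * y (h^-1 * g)%g].

Lemma galg_DE x y g : (x + y) g = x g + y g.
Proof. exact: ffunE. Qed.

Fact galg_mulA : associative galg_mul.
Proof.
move=> x y z; apply/ffunP=> g; rewrite !ffunE.
under eq_bigr => h _ do rewrite ffunE mulr_sumr.
under [RHS]eq_bigr => h _ do rewrite ffunE mulr_suml.
rewrite [RHS]exchange_big /=; apply: eq_bigr => h _.
rewrite (reindex_inj (mulgI h^-1%g)) /=; apply: eq_bigr => k _.
by rewrite mulrA invMg invgK mulgA mulgK.
Qed.

Fact galg_mul1 : left_id (galg_elt 1) galg_mul.
Proof.
move=> x; apply/ffunP=> g; rewrite !ffunE (bigD1 1%g) //= big1 => [|h /negPf h1].
  by rewrite ffunE eqxx mul1r invg1 mul1g addr0.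
by rewrite ffunE h1 mul0r.
Qed.

Fact galg_mulr1 : right_id (galg_elt 1) galg_mul.
Proof.
move=> x; apply/ffunP=> g; rewrite !ffunE (bigD1 g) //= big1 => [|h hg].
  by rewrite ffunE mulVg eqxx mulr1 addr0.
by rewrite ffunE -eq_mulVg1 (negPf hg) mulr0.
Qed.

Fact galg_mulDl : left_distributive galg_mul +%R.
Proof.
move=> x y z; apply/ffunP=> g; rewrite !ffunE -big_split /=.
by apply: eq_bigr => h _; rewrite galg_DE mulrDl.
Qed.

Fact galg_mulDr : right_distributive galg_mul +%R.
Proof.
move=> x y z; apply/ffunP=> g; rewrite !ffunE -big_split /=.
by apply: eq_bigr => h _; rewrite galg_DE mulrDr.
Qed.

HB.instance Definition _ := GRing.Zmodule_isPzRing.Build group_algebra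
  galg_mulA galg_mul1 galg_mulr1 galg_mulDl galg_mulDr.

Lemma galg_ME x y g : (x * y) g = \sum_h x h * y (h^-1 * g)%g.
Proof. exact: ffunE. Qed.

End GroupAlgebra.

(* For an [RG]-module [V], [V / l V] as a module over the group algebra of
   [R / l R]: coefficients act through arbitrary lifts to [R]. *)
Section Reduction.
Variables (R : comPzRingType) (gT : finGroupType) (l : nat).
Variable V : lmodType (group_algebra R gT).

Definition reduction := Quotient.quot (multiples V l).

HB.instance Definition _ := GRing.Zmodule.on reduction.

Local Notation K := (residue_ring R l).
Local Notation piR := (\pi_(Quotient.quot (multiples R l))).
Local Notation piV := (\pi_(Quotient.quot (multiples V l))).

Definition galg_lift (a : group_algebra K gT) : group_algebra R gT :=
  [ffun g => repr (a g)].
Definition galg_reduce (a : group_algebra R gT) : group_algebra K gT :=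
  [ffun g => piR (a g)].

Definition reduction_scale (a : group_algebra K gT) (x : reduction) : reduction :=
  piV (galg_lift a *: repr x).

Lemma galg_liftK a : galg_reduce (galg_lift a) = a.
Proof. by apply/ffunP=> g; rewrite !ffunE reprK. Qed.

Lemma galg_reduceD : {morph galg_reduce : a b / a + b}.
Proof. by move=> a b; apply/ffunP=> g; rewrite !ffunE raddfD. Qed.

Lemma galg_reduceM : {morph galg_reduce : a b / a * b}.
Proof.
move=> a b; apply/ffunP=> g; rewrite !ffunE raddf_sum /=.
by apply: eq_bigr => h _; rewrite !ffunE -residue_piM.
Qed.

Lemma galg_reduce1 : galg_reduce 1 = 1.
Proof.
apply/ffunP=> g; rewrite !ffunE; case: eqP => _ //=.
by rewrite raddf0.
Qed.

Lemma reduction_reprK (x : reduction) : piV (repr x) = x.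
Proof. exact: reprK. Qed.

Lemma reduction_piD u v : piV (u + v) = piV u + piV v :> reduction.
Proof. exact: raddfD. Qed.

Lemma reduction_piZ a v :
  reduction_scale (galg_reduce a) (piV v) = piV (a *: v).
Proof.
apply/eqP; rewrite /reduction_scale -Quotient.idealrBE.
set b := galg_lift _.
have /fin_all_exists[c Ec] : forall g, exists c, b g - a g = c *+ l.
  by move=> g; apply/multiplesP; rewrite Quotient.idealrBE !ffunE reprK.
have /multiplesP[w Ew] : repr (piV v) - v \in multiples V l.
  by rewrite Quotient.idealrBE reprK.
have Eb : b - a = ([ffun g => c g] : group_algebra R gT) *+ l.
  apply/ffunP=> g; have -> : (b - a) g = b g - a g by rewrite !ffunE.
  by rewrite Ec ffunMnE ffunE.
apply/multiplesP; exists (([ffun g => c g] : group_algebra R gT) *: repr (piV v) + a *: w).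
rewrite mulrnDl [a *: w *+ l]scalerMnr -Ew scalerMnl -Eb scalerBl scalerBr.
by rewrite addrA subrK.
Qed.

Fact reduction_scaleA a b x :
  reduction_scale a (reduction_scale b x) = reduction_scale (a * b) x.
Proof.
rewrite -[x]reduction_reprK -[a]galg_liftK -[b]galg_liftK -galg_reduceM.
by rewrite !reduction_piZ scalerA.
Qed.
Fact reduction_scale1 : left_id 1 reduction_scale.
Proof. by move=> x; rewrite -[x]reduction_reprK -galg_reduce1 reduction_piZ scale1r. Qed.
Fact reduction_scaleDr : right_distributive reduction_scale +%R.
Proof.
move=> a x y; rewrite -[x]reduction_reprK -[y]reduction_reprK -[a]galg_liftK -reduction_piD.
by rewrite !reduction_piZ -reduction_piD scalerDr.
Qed.
Fact reduction_scaleDl x : {morph reduction_scale^~ x : a b / a + b}.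
Proof.
move=> a b; rewrite -[x]reduction_reprK -[a]galg_liftK -[b]galg_liftK -galg_reduceD.
by rewrite !reduction_piZ -reduction_piD scalerDl.
Qed.

HB.instance Definition _ := GRing.Zmodule_isLmodule.Build
  (group_algebra K gT) reduction
  reduction_scaleA reduction_scale1 reduction_scaleDr reduction_scaleDl.

End Reduction.

(* [{'GL_n[F]}] consists of matrices of size [n.-1.+1], which is [n] as soon
   as [0 < n]. *)
Section Steinberg.
Variables (R : idomainType) (F : finFieldType) (n l : nat).

Local Notation G := {'GL_n[F]}.
Local Notation RG := (group_algebra R G).
Local Notation K := (residue_ring R l).
Local Notation KG := (group_algebra K G).

Definition borel : {set G} :=
  [set g : G | [forall i : 'I_n.-1.+1, forall j : 'I_n.-1.+1, (j < i)%N ==> (GLval g i j == 0)]].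

Definition perm_GL (s : 'S_n.-1.+1) : G := FinRing.unit _ (unitmx_perm F s).

Definition steinberg_elt : RG :=
  \sum_(s : 'S_n.-1.+1) (-1) ^+ s * galg_elt R (perm_GL s) * galg_sum R borel.

Definition steinberg_ideal : {pred RG^o} :=
  fun x => `[< exists a : RG, x = a * steinberg_elt >].

Lemma steinberg_idealP x :
  reflect (exists a : RG, x = a * steinberg_elt) (x \in steinberg_ideal).
Proof. exact: asboolP. Qed.

Fact steinberg_ideal_closed : subsemimod_closed steinberg_ideal.
Proof.
split=> [|b x /steinberg_idealP[a ->]].
  split=> [|x y /steinberg_idealP[a ->] /steinberg_idealP[b ->]].
    by apply/steinberg_idealP; exists 0; rewrite mul0r.
  by apply/steinberg_idealP; exists (a + b); rewrite mulrDl.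
by apply/steinberg_idealP; exists (b * a); rewrite -mulrA.
Qed.
HB.instance Definition _ := GRing.isSubmodClosed.Build RG RG^o steinberg_ideal
  steinberg_ideal_closed.

Definition steinberg : lmodType RG := submodule_type steinberg_ideal.

Definition galg_form (x y : RG) : R := \sum_(g : G) x g * y g.

(* The order of [borel] need not be invertible in [R], so the scaled form is
   written in the fraction field; [steinberg_form_int] shows that its values
   are in [R]. *)
Definition steinberg_form (x y : steinberg) : {fraction R} :=
  tofrac (galg_form (val x) (val y)) / #|borel|%:R.

Lemma borel_group_set : group_set borel.
Proof.
apply/group_setP; split=> [|g h].
  rewrite inE; apply/forallP=> i; apply/forallP=> j; apply/implyP=> ji.
  by rewrite GL_1E mxE -(inj_eq val_inj) (gtn_eqF ji).
rewrite !inE => /forallP gB /forallP hB.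
apply/forallP=> i; apply/forallP=> j; apply/implyP=> ji.
rewrite GL_MxE mxE big1 // => k _.
have [ki|ik] := ltnP k i.
  by move/forallP/(_ k): (gB i); rewrite ki => /eqP->; rewrite mul0r.
move/forallP/(_ j): (hB k); rewrite (leq_trans ji ik) => /eqP->.
by rewrite mulr0.
Qed.

Canonical borel_group := Group borel_group_set.

Lemma galg_sumE (S : {set G}) g : galg_sum R S g = (g \in S)%:R.
Proof.
rewrite /galg_sum sum_ffunE; have [gS|gS] := boolP (g \in S).
  rewrite (bigD1 g) //= ffunE eqxx big1 ?addr0 // => h /andP[_ hg].
  by rewrite ffunE eq_sym (negPf hg).
rewrite big1 // => h hS; rewrite ffunE; case: eqP => // gh.
by rewrite gh hS in gS.
Qed.

Lemma steinberg_coset (x : steinberg) g b :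
  b \in borel -> (val x : RG) (g * b)%g = (val x : RG) g.
Proof.
case: x => x /= /steinberg_idealP[a ->] bB.
rewrite /steinberg_elt -mulr_suml mulrA !galg_ME; apply: eq_bigr => h _.
by rewrite !galg_sumE mulgA (groupMr (G := borel_group)).
Qed.

Lemma galg_form_borel (x y : steinberg) :
  galg_form (val x) (val y) \in multiples R #|borel|.
Proof.
rewrite /galg_form (partition_big (fun g => (g *: borel)%g) xpredT) //=.
apply: rpred_sum => C _.
have [g0 /eqP g0C|noC] := pickP (fun g => (g *: borel)%g == C); last first.
  by rewrite big_pred0 ?rpred0.
rewrite (eq_bigr (fun=> (val x : RG) g0 * (val y : RG) g0)) => [|g /eqP gC].
  have -> : \sum_(g | (g *: borel)%g == C) (val x : RG) g0 * (val y : RG) g0 =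
      \sum_(g in C) (val x : RG) g0 * (val y : RG) g0.
    apply: eq_bigl => g; rewrite -g0C; apply/eqP/idP => [<-|/lcoset_eqP->] //.
    exact: (lcoset_refl borel_group).
  rewrite sumr_const -g0C card_lcoset; apply/multiplesP.
  by exists ((val x : RG) g0 * (val y : RG) g0).
have /lcosetP[b bB ->] : g \in (g0 *: borel)%g.
  by rewrite g0C -gC (lcoset_refl borel_group).
by rewrite !steinberg_coset.
Qed.

Lemma steinberg_form_int x y : exists r : R, steinberg_form x y = tofrac r.
Proof.
have /multiplesP[r Er] := galg_form_borel x y.
rewrite /steinberg_form Er rmorphMn /=.
have [B0|B0] := eqVneq (#|borel|%:R : {fraction R}) 0.
  by exists 0; rewrite B0 invr0 mulr0 rmorph0.
by exists r; rewrite -mulr_natr mulfK.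
Qed.

(* This is I(c); its image in I / l I is the submodule L(c), [layer c] below. *)
Definition steinberg_layer (c : nat) (x : steinberg) : Prop :=
  forall y : steinberg, exists r : R, steinberg_form x y = tofrac (l%:R ^+ c * r).

Definition galg_adj (a : RG) : RG := [ffun g => a g^-1%g].

Lemma galg_form_adj (a x y : RG) :
  galg_form (a * x) y = galg_form x (galg_adj a * y).
Proof.
rewrite /galg_form; under eq_bigr => g _ do rewrite galg_ME mulr_suml.
rewrite exchange_big /=.
under [RHS]eq_bigr => g _ do rewrite galg_ME mulr_sumr.
rewrite [RHS]exchange_big /= [RHS](reindex_inj invg_inj) /=.
apply: eq_bigr => h _; rewrite (reindex_inj (mulgI h)) /=.
by apply: eq_bigr => g _; rewrite ffunE !invgK mulKg mulrCA mulrA.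
Qed.

Lemma galg_formDl (x y z : RG) :
  galg_form (x + y) z = galg_form x z + galg_form y z.
Proof.
rewrite /galg_form -big_split /=; apply: eq_bigr => g _.
by rewrite galg_DE mulrDl.
Qed.

Lemma galg_form0 (x : RG) : galg_form 0 x = 0.
Proof. by rewrite /galg_form big1 // => g _; rewrite ffunE mul0r. Qed.

Lemma steinberg_layer0 c : steinberg_layer c 0.
Proof.
move=> y; exists 0; rewrite mulr0 rmorph0 /steinberg_form.
by rewrite -[val 0]/(0 : RG) galg_form0 rmorph0 mul0r.
Qed.

Lemma steinberg_layerD c x y :
  steinberg_layer c x -> steinberg_layer c y -> steinberg_layer c (x + y).
Proof.
move=> cx cy z; have [[r Er] [s Es]] := (cx z, cy z); exists (r + s).
rewrite /steinberg_form raddfD /= galg_formDl rmorphD /= mulrDl.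
by rewrite mulrDr [RHS]rmorphD /= -Er -Es.
Qed.

Lemma steinberg_valZ a (x : steinberg) : val (a *: x) = (a : RG) * (val x : RG).
Proof. by case: x. Qed.

Lemma steinberg_layerZ c a x : steinberg_layer c x -> steinberg_layer c (a *: x).
Proof.
move=> cx y; have [r Er] := cx (galg_adj a *: y).
by exists r; rewrite -Er /steinberg_form !steinberg_valZ galg_form_adj.
Qed.

Definition steinberg_mod : lmodType KG := reduction l steinberg.

Local Notation piL := (\pi_(Quotient.quot (multiples steinberg l))).

Definition layer (c : nat) : {pred steinberg_mod} :=
  fun x => `[< exists u w : steinberg,
    [/\ steinberg_layer c u, w \in multiples steinberg l & x = piL (u + w)] >].

Lemma layerP c x :
  reflect (exists2 u : steinberg, steinberg_layer c u & x = piL u)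
          (x \in layer c).
Proof.
apply: (iffP idP) => [/asboolP[u [w [cu wl ->]]]|[u cu ->]].
  exists u => //; apply/eqP.
  by rewrite -Quotient.idealrBE addrC addKr.
by apply/asboolP; exists u, 0; rewrite rpred0 addr0.
Qed.

Fact layer_closed c : subsemimod_closed (layer c).
Proof.
split=> [|a x /layerP[u cu ->]].
  split=> [|x y /layerP[u cu ->] /layerP[v cv ->]]; apply/layerP.
    by exists 0; [exact: steinberg_layer0 | rewrite raddf0].
  by exists (u + v); [exact: steinberg_layerD | rewrite raddfD].
apply/layerP; exists (galg_lift a *: u); first exact: steinberg_layerZ.
by rewrite -[in LHS](galg_liftK a) -reduction_piZ.
Qed.
HB.instance Definition _ c := GRing.isSubmodClosed.Build KG steinberg_mod (layer c)
  (layer_closed c).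

Lemma layer0 x : x \in layer 0.
Proof.
apply/layerP; exists (repr x); last by rewrite reprK.
by move=> y; have [r ->] := steinberg_form_int (repr x) y; exists r; rewrite mul1r.
Qed.

Lemma layerS c x : x \in layer c.+1 -> x \in layer c.
Proof.
case/layerP=> u cu ->; apply/layerP; exists u => // y.
by have [r ->] := cu y; exists (l%:R * r); rewrite exprSr mulrA.
Qed.

Definition next_layer (c : nat) : {pred submodule_type (layer c)} :=
  fun x => val x \in layer c.+1.
Arguments next_layer : clear implicits.

Fact next_layer_closed c : subsemimod_closed (next_layer c).
Proof.
split=> [|a x xc]; last by rewrite unfold_in /next_layer linearZ rpredZ.
split=> [|x y xc yc]; rewrite unfold_in /next_layer.
  by rewrite raddf0 rpred0.
by rewrite raddfD rpredD.
Qed.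
HB.instance Definition _ c := GRing.isSubmodClosed.Build KG
  (submodule_type (layer c)) (next_layer c) (next_layer_closed c).

Definition layer_factor (c : nat) : lmodType KG := quotient_module (next_layer c).

End Steinberg.
Arguments steinberg : clear implicits.
Arguments steinberg_form {R F n}.
Arguments steinberg_layer {R F n}.
Arguments steinberg_mod : clear implicits.
Arguments layer : clear implicits.
Arguments layer_factor : clear implicits.

(* Main.v *)
Require Import Defs.
From mathcomp Require Import all_boot all_order all_fingroup all_algebra.
From mathcomp Require Import all_solvable all_field.
From mathcomp Require Import boolp.
From mathcomp Require Import zify ring.

Set Implicit Arguments.
Unset Strict Implicit.
Unset Printing Implicit Defensive.

Import GRing.Theory generic_quotient.
Local Open Scope ring_scope.
Local Open Scope quotient_scope.

(** The idea is to look at the submodules of the Steinberg lattice I through the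
   linear characters of the group U of unitriangular matrices.

   Fix a nontrivial additive character psi of F.  A matrix D supported on the
   subdiagonal gives the linear character u |-> psi (tr (D u)) of U, and
   [whittaker 0 D], written W_D here, is |U| times the corresponding idempotent;
   D is generic when none of its subdiagonal entries vanishes.  Write eps for the
   generator of I.  Since I = RU eps [steinberg_unitri_span], every x in I
   satisfies W_D x = c W_D eps for some scalar c: each linear character of U
   occurs at most once.

   Let N be a submodule of I containing l I.  If W_D x = c W_D eps with x in N,
   D generic and c outside l R, then c is invertible modulo l, so N contains
   W_D eps, and N = I because W_D eps generates I modulo l [whittaker_generates].
   Otherwise W_D N is contained in l I for every generic D.  The adjoint of W_D
   for the bilinear form f is W_(-D), so f (x, a W_D eps) = f (W_(-D) (adj a) x, eps)
   is divisible by l for x in N; as W_D eps generates I modulo l, this puts N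
   inside I(1) [degenerate_in_radical].  Hence L(0) / L(1) has no proper nonzero
   submodule, and it is not zero because f (eps, W_D eps) = 1 for generic D
   [galg_bform_whittaker].

   There remains the generation of I by W_D eps, D generic, and it has two steps.
   The first one reaches every linear character of U [whittaker_degenerate].
   Given D, let J be the set of its nonzero entries and let w be the longest
   element of the Levi Weyl group attached to J.  For a suitable generic D', the
   element W_D w w0 W_D' eps is c W_D eps.  For generic D', W_D' eps lives on the
   big cell U w0 B only, and evaluating at w gives a sum over U all of whose terms
   equal the same sign; so c divides |U|, which is prime to l.

   The second step passes from the linear characters of U to the identity
   [sum_whittaker_add_row, whittaker_add_row_conj].  Let U_k be the subgroup of U
   where only the columns of index at least k are nontrivial.  Then U_(k+1) is the
   subgroup of U_k where column k is trivial, so a power of q times the element W_D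
   of U_(k+1) is the sum of the elements W of U_k over all characters of column k.
   The upper left block GL_k moves any character of column k to one that only
   involves its last entry, that is to a linear character of the kind already
   treated.  Descending from U_0 = U to the trivial group, we get eps itself.
   This is the mirabolic argument of Gelfand and Kazhdan. *)

(** * Group algebras and additive characters *)

Section GroupAlgebraTheory.
Variables (R : comPzRingType) (gT : finGroupType).
Local Notation RG := (group_algebra R gT).
Local Notation delta := (@galg_elt R gT).
Implicit Types (x y : RG) (g h : gT) (r : R).

(** The group algebra is only a ring here, so scalars act through this central
   copy of R. *)
Definition scal r : RG := [ffun g => r * (g == 1%g)%:R].

Lemma galg_eltE g h : delta g h = (h == g)%:R.
Proof. exact: ffunE. Qed.

Lemma galg_elt_mulE g x h : (delta g * x) h = x (g^-1 * h)%g.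
Proof.
rewrite galg_ME (bigD1 g) //= galg_eltE eqxx mul1r big1 ?addr0 // => k kg.
by rewrite galg_eltE (negPf kg) mul0r.
Qed.

Lemma galg_mul_eltE g x h : (x * delta g) h = x (h * g^-1)%g.
Proof.
rewrite galg_ME (bigD1 (h * g^-1)%g) //= galg_eltE invMg invgK mulgKV eqxx.
rewrite mulr1 big1 ?addr0 // => k kg.
rewrite galg_eltE; case: eqP => [E|]; last by rewrite mulr0.
by rewrite -E invMg invgK mulKVg eqxx in kg.
Qed.

Lemma galg_eltM g h : delta (g * h)%g = delta g * delta h.
Proof.
by apply/ffunP=> k; rewrite galg_elt_mulE !galg_eltE -(canF_eq (mulKVg g)).
Qed.

Lemma galg_elt1 : delta 1%g = 1.
Proof. by []. Qed.

Lemma scalE r x g : (scal r * x) g = r * x g.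
Proof.
rewrite galg_ME (bigD1 1%g) //= ffunE eqxx mulr1 invg1 mul1g big1 ?addr0 // => k k1.
by rewrite ffunE (negPf k1) mulr0 mul0r.
Qed.

Lemma scalC r x : scal r * x = x * scal r.
Proof.
apply/ffunP=> g; rewrite scalE galg_ME (bigD1 g) //= ffunE mulVg eqxx mulr1 mulrC.
rewrite big1 ?addr0 // => k kg.
by rewrite ffunE -eq_mulVg1 (negPf kg) !mulr0.
Qed.

Lemma scalAC x r y : x * (scal r * y) = scal r * (x * y).
Proof. by rewrite mulrA -scalC mulrA. Qed.

Lemma scalM r s : scal (r * s) = scal r * scal s.
Proof. by apply/ffunP=> g; rewrite scalE !ffunE mulrA. Qed.

Lemma scalD r s : scal (r + s) = scal r + scal s.
Proof. by apply/ffunP=> g; rewrite !ffunE mulrDl. Qed.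

Lemma scal1 : scal 1 = 1.
Proof. by apply/ffunP=> g; rewrite !ffunE mul1r. Qed.

Lemma scalN r : scal (- r) = - scal r.
Proof. by apply/ffunP=> g; rewrite !ffunE mulNr. Qed.

Lemma scal_sign (b : bool) : scal ((-1) ^+ b) = (-1) ^+ b.
Proof. by case: b; rewrite ?scalN scal1. Qed.

Lemma signAC (b : bool) x y : x * ((-1) ^+ b * y) = (-1) ^+ b * (x * y).
Proof. by rewrite -scal_sign scalAC. Qed.

Lemma galg_decomp x : x = \sum_g scal (x g) * delta g.
Proof.
apply/ffunP=> h; rewrite sum_ffunE (bigD1 h) //= scalE galg_eltE eqxx mulr1.
rewrite big1 ?addr0 // => k kh.
by rewrite scalE galg_eltE eq_sym (negPf kh) mulr0.
Qed.

Lemma galg_elt_sum g (S : {group gT}) : g \in S ->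
  delta g * galg_sum R S = galg_sum R S.
Proof.
move=> gS; rewrite /galg_sum mulr_sumr [RHS](reindex_inj (mulgI g)) /=.
by apply: eq_big => h; [rewrite groupMl | rewrite galg_eltM].
Qed.

Lemma galg_sum_coefE (S : {set gT}) g : galg_sum R S g = (g \in S)%:R.
Proof.
rewrite /galg_sum sum_ffunE big_mkcond (bigD1 g) //= big1 ?addr0 => [|h hg].
  by rewrite galg_eltE eqxx; case: ifP.
by rewrite galg_eltE eq_sym (negPf hg); case: ifP.
Qed.

End GroupAlgebraTheory.

Lemma sum_character_eq0 (A : finZmodType) (R : idomainType) (chi : A -> R) (a0 : A) :
    {morph chi : a b / a + b >-> a * b} -> chi a0 != 1 ->
  \sum_a chi a = 0.
Proof.
move=> chiD chi_a0.
have: (chi a0 - 1) * \sum_a chi a = 0.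
  rewrite mulrBl mul1r [X in _ - X](reindex_inj (addrI a0)) /= mulr_sumr.
  by rewrite -sumrB big1 // => a _; rewrite chiD subrr.
by move/eqP; rewrite mulf_eq0 subr_eq0 (negPf chi_a0) => /eqP.
Qed.

Definition additive_character (F R : nzRingType) (psi : F -> R) :=
  [/\ {morph psi : a b / a + b >-> a * b}, psi 0 = 1 & exists t, psi t != 1].

(** A coordinate of F over its prime field gives an additive map onto 'F_p, which
   is then exponentiated with base the root of unity. *)
Lemma exists_additive_character (F : finFieldType) (p : nat) (R : idomainType) (z : R) :
    p \in [pchar F] -> p.-primitive_root z ->
  exists psi : F -> R, additive_character psi.
Proof.
move=> pF z_prim; have p_pr := pcharf_prime pF.
pose V := pPrimeCharType pF.
have [i phi1] : exists i, coord (vbasis {:V}) i (1 : V) != 0.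
  apply/existsP; apply: contraT; rewrite negb_exists => /forallP phi0.
  have /eqP[] := oner_neq0 V; rewrite (coord_vbasis (memvf (1 : V))) big1 // => i _.
  by have /negPn/eqP-> := phi0 i; rewrite scale0r.
pose phi (a : F) : 'F_p := coord (vbasis {:V}) i (a : V).
exists (fun a => z ^+ phi a); split=> [a b||].
  have -> : phi (a + b) = phi a + phi b by exact: (raddfD (coord (vbasis {:V}) i)).
  have -> : nat_of_ord (phi a + phi b) = ((phi a + phi b) %% p)%N.
    by congr (_ %% _)%N; exact: Fp_cast.
  by rewrite prim_expr_mod // exprD.
  have phi0 : phi 0 = 0 by exact: (raddf0 (coord (vbasis {:V}) i)).
  by rewrite phi0 expr0.
exists 1; rewrite -(prim_order_dvd z_prim) gtnNdvd //.
  by rewrite lt0n.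
by rewrite -[X in (_ < X)%N](Fp_cast p_pr).
Qed.

(** * The general linear group and its Steinberg generator *)

(** The group is repackaged as a constant of type [finGroupType]: elements are
   then typed through a single chain of group structures, instead of the
   competing one that unfolds units of the matrix ring. *)
Definition GLn (F : finFieldType) (m : nat) : finGroupType := {'GL_m.+1[F]}.

Section GLn.
Variables (F : finFieldType) (m : nat).
Local Notation G := (GLn F m).
Implicit Types g h : G.

Definition GLmx g : 'M[F]_m.+1 := @GLval m.+1 F g.
Definition mkGL (A : 'M[F]_m.+1) : G := insubd (1%g : {'GL_m.+1[F]}) A.
Definition Borel : {set G} := borel F m.+1.
Definition perm_elt (s : 'S_m.+1) : G := perm_GL F (n := m.+1) s.

Lemma GLmx_inj : injective GLmx.
Proof.
move=> g h gh.
exact: (val_inj (gh : val (g : {'GL_m.+1[F]}) = val (h : {'GL_m.+1[F]}))).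
Qed.
Lemma GLmxM g h : GLmx (g * h)%g = GLmx g *m GLmx h.
Proof. exact (@GL_MxE m.+1 F g h). Qed.
Lemma GLmx1 : GLmx 1%g = 1%:M.
Proof. exact (@GL_1E m.+1 F). Qed.
Lemma GLmx_unit g : GLmx g \in unitmx.
Proof. exact (@GL_unitmx m.+1 F g). Qed.
Lemma mkGLE A : A \in unitmx -> GLmx (mkGL A) = A.
Proof. by move=> uA; exact: (insubdK (1%g : {'GL_m.+1[F]})). Qed.
Lemma perm_eltE s : GLmx (perm_elt s) = perm_mx s.
Proof. by []. Qed.
Lemma Borel_group_set : group_set Borel.
Proof. exact (@borel_group_set F m.+1). Qed.
Lemma BorelP g : reflect (forall i j : 'I_m.+1, (j < i)%N -> GLmx g i j = 0) (g \in Borel).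
Proof.
rewrite inE; apply: (iffP forallP) => [gB i j ji | gB i].
  by move/forallP/(_ j)/implyP/(_ ji)/eqP: (gB i).
by apply/forallP=> j; apply/implyP=> ji; apply/eqP/gB.
Qed.

End GLn.

Definition steinberg_gen (R : idomainType) (F : finFieldType) (m : nat) :
  group_algebra R (GLn F m) := steinberg_elt R F m.+1.

Lemma steinberg_genE R F m : steinberg_gen R F m =
  \sum_(s : 'S_m.+1) (-1) ^+ s * (galg_elt R (perm_elt F s) * galg_sum R (Borel F m)).
Proof. by apply: eq_bigr => s _; rewrite mulrA. Qed.

Section FormTransfer.
Variables (R : idomainType) (F : finFieldType) (m : nat).
Local Notation RG := (group_algebra R (GLn F m)).
Local Notation eps := (steinberg_gen R F m).

(** The unscaled form: the form of the lattice is this one divided by |B|. *)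
Definition galg_bform (x y : RG) : R := @galg_form R F m.+1 x y.
Definition gadj (a : RG) : RG := @galg_adj R F m.+1 a.

Lemma galg_bformE x y : galg_bform x y = \sum_g x g * y g.
Proof. by []. Qed.
Lemma gadjE a g : gadj a g = a g^-1%g.
Proof. exact: ffunE. Qed.
Lemma galg_bform_adj a x y : galg_bform (a * x) y = galg_bform x (gadj a * y).
Proof. exact (@galg_form_adj R F m.+1 a x y). Qed.
Lemma steinberg_ideal_mul a :
  (a * eps : group_algebra R {'GL_m.+1[F]}) \in @steinberg_ideal R F m.+1.
Proof. by apply/steinberg_idealP; exists a. Qed.

Definition steinberg_mul a : steinberg R F m.+1 := Submodule (steinberg_ideal_mul a).

Lemma galg_bform_Borel a b : exists r, galg_bform (a * eps) (b * eps) = r *+ #|Borel F m|.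
Proof.
have /multiplesP[r E] := @galg_form_borel R F m.+1 (steinberg_mul a) (steinberg_mul b).
by exists r.
Qed.

End FormTransfer.

(** * Unitriangular matrices, permutations and root elements *)

Section OpaqueGroup.

#[local] Opaque GLn steinberg_gen galg_elt galg_sum galg_mul Borel perm_elt GLmx mkGL.
#[local] Opaque galg_bform gadj.

Canonical Borel_group F m := Group (@Borel_group_set F m).

Section Matrices.
Variables (F : finFieldType) (m : nat).
Local Notation G := (GLn F m).
Local Notation B := (Borel F m).
Local Notation P := (@perm_elt F m).
Implicit Types (g h u v b : G) (i j : 'I_m.+1) (s : 'S_m.+1).

Lemma perm_elt_coefE s i j : GLmx (P s) i j = (s i == j)%:R.
Proof. by rewrite perm_eltE !mxE. Qed.

Lemma perm_eltM s t : P (s * t)%g = (P s * P t)%g.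
Proof. by apply: GLmx_inj; rewrite GLmxM !perm_eltE perm_mxM. Qed.

Lemma perm_elt1 : P 1%g = 1%g.
Proof. by apply: GLmx_inj; rewrite GLmx1 perm_eltE perm_mx1. Qed.

Lemma perm_eltV s : P s^-1%g = (P s)^-1%g.
Proof. by apply: (mulgI (P s)); rewrite -perm_eltM !mulgV perm_elt1. Qed.

Lemma perm_conjE s g i j : GLmx (P s * g * (P s)^-1)%g i j = GLmx g (s i) (s j).
Proof.
by rewrite -perm_eltV !GLmxM !perm_eltE -row_permE -col_permE !mxE.
Qed.

Lemma perm_conjVE s g i j :
  GLmx ((P s)^-1 * g * P s)%g i j = GLmx g ((s^-1)%g i) ((s^-1)%g j).
Proof. by rewrite -perm_conjE perm_eltV invgK. Qed.

(** [unitri 0] is the unitriangular group U; as k grows, these subgroups interpolate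
   between U and the trivial group by trivialising one more column at a time. *)
Definition unitri (k : nat) : {set G} :=
  [set g : G | [forall i : 'I_m.+1, forall j : 'I_m.+1,
     (i < j)%N && (k <= j)%N || (GLmx g i j == (i == j)%:R)]].

Lemma unitriP k g :
  reflect (forall i j, ~~ ((i < j)%N && (k <= j)%N) -> GLmx g i j = (i == j)%:R)
          (g \in unitri k).
Proof.
rewrite inE; apply: (iffP forallP) => [gU i j /negPf nij | gU i].
  by move/forallP/(_ j): (gU i); rewrite nij => /eqP.
apply/forallP=> j; case: (boolP (_ && _)) => //= nij.
by rewrite gU.
Qed.

Lemma unitri0P g :
  reflect (forall i j, (j <= i)%N -> GLmx g i j = (i == j)%:R) (g \in unitri 0).
Proof.
apply: (iffP (unitriP 0 g)) => gU i j ij; apply: gU.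
  by rewrite andbT -leqNgt.
by rewrite andbT -leqNgt in ij.
Qed.

Lemma unitri_group_set : group_set (unitri 0).
Proof.
apply/group_setP; split=> [|u v /unitri0P uU /unitri0P vU]; apply/unitri0P=> i j ji.
  by rewrite GLmx1 mxE.
rewrite GLmxM mxE (bigD1 i) //= uU // eqxx mul1r vU // big1 ?addr0 // => k ki.
have [lt_ki|le_ik] := ltnP k i.
  by rewrite uU ?(ltnW lt_ki) // eq_sym (negPf ki) mul0r.
rewrite vU ?(leq_trans ji le_ik) // (_ : (k == j) = false) ?mulr0 //.
apply: contraNF ki => /eqP kj; rewrite -(inj_eq val_inj) /= eqn_leq le_ik andbT.
by rewrite kj.
Qed.
Canonical unitri_group := Group unitri_group_set.

Lemma unitri_sub_Borel u : u \in unitri 0 -> u \in B.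
Proof.
move/unitri0P=> uU; apply/BorelP=> i j ji; rewrite uU ?(ltnW ji) //.
by rewrite -(inj_eq val_inj) /= gtn_eqF.
Qed.

Definition subdiag (D : 'M[F]_m.+1) := forall i j, i != j.+1 :> nat -> D i j = 0.
Definition generic_subdiag (D : 'M[F]_m.+1) :=
  subdiag D /\ forall i j, i = j.+1 :> nat -> D i j != 0.

Lemma mxtrace_mulE (D A : 'M[F]_m.+1) : \tr (D *m A) = \sum_i \sum_j D i j * A j i.
Proof. by apply: eq_bigr => i _; rewrite mxE. Qed.

(** U modulo its commutator subgroup is read on the entries next to the diagonal,
   which add up; these are the entries that a subdiagonal matrix sees. *)
Lemma unitri_superdiagM u v i j : u \in unitri 0 -> v \in unitri 0 -> i = j.+1 :> nat ->
  GLmx (u * v)%g j i = GLmx u j i + GLmx v j i.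
Proof.
move=> /unitri0P uU /unitri0P vU ij; rewrite GLmxM mxE.
have neq_ji : j != i by rewrite -(inj_eq val_inj) /= ij; lia.
rewrite (bigD1 i) //= (bigD1 j) //= (vU i i) // (uU j j) // !eqxx mulr1 mul1r.
rewrite big1 ?addr0 // => k /andP[ki kj].
have [lt_kj|le_jk] := ltnP k j.
  by rewrite uU ?(ltnW lt_kj) // eq_sym (negPf kj) mul0r.
rewrite vU; first by rewrite (negPf ki) mulr0.
move: ki kj; rewrite -!(inj_eq val_inj) /= => ki kj; lia.
Qed.

Lemma subdiag_trM D u v : subdiag D -> u \in unitri 0 -> v \in unitri 0 ->
  \tr (D *m GLmx (u * v)%g) = \tr (D *m GLmx u) + \tr (D *m GLmx v).
Proof.
move=> sD uU vU; rewrite !mxtrace_mulE -big_split; apply: eq_bigr => i _ /=.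
rewrite -big_split; apply: eq_bigr => j _ /=.
have [ij|ij] := eqVneq (i : nat) j.+1; last by rewrite sD // !mul0r addr0.
by rewrite unitri_superdiagM // mulrDr.
Qed.

Lemma subdiag_tr1 D : subdiag D -> \tr (D *m GLmx (1%g : G)) = 0.
Proof.
move=> sD; have := subdiag_trM sD (group1 _) (group1 _).
by rewrite mulg1 -[X in X = _]addr0 => /addrI.
Qed.

Lemma subdiag_trV D u : subdiag D -> u \in unitri 0 ->
  \tr (D *m GLmx u^-1%g) = - \tr (D *m GLmx u).
Proof.
move=> sD uU; apply/eqP; rewrite -addr_eq0 -subdiag_trM ?groupV //.
by rewrite mulVg subdiag_tr1.
Qed.

Definition root_elt i j (t : F) : G := mkGL (1%:M + t *: delta_mx i j).

Lemma root_eltE i j t : i != j -> GLmx (root_elt i j t) = 1%:M + t *: delta_mx i j.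
Proof.
move=> ij; apply: mkGLE.
have E : (1%:M + t *: delta_mx i j) *m (1%:M - t *: delta_mx i j) = 1%:M :> 'M[F]_m.+1.
  rewrite mulmxBr mulmx1 mulmxDl mul1mx -scalemxAl -scalemxAr mul_delta_mx_0 //.
    by rewrite !scaler0 addr0 addrK.
  by rewrite eq_sym.
by have [] := mulmx1_unit E.
Qed.

Lemma root_elt_coefE i j t (a b : 'I_m.+1) : i != j ->
  GLmx (root_elt i j t) a b = (a == b)%:R + t * ((a == i) && (b == j))%:R.
Proof. by move=> ij; rewrite root_eltE // !mxE. Qed.

Lemma root_eltD i j t t' : i != j -> root_elt i j (t + t') = (root_elt i j t * root_elt i j t')%g.
Proof.
move=> ij; apply: GLmx_inj; rewrite GLmxM !root_eltE // mulmxDl mul1mx mulmxDr mulmx1.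
rewrite -scalemxAl -scalemxAr mul_delta_mx_0 ?(eq_sym j) // !scaler0 addr0 -addrA scalerDl.
by rewrite [t *: _ + _]addrC.
Qed.

Lemma root_elt0 i j : i != j -> root_elt i j 0 = 1%g.
Proof. by move=> ij; apply: GLmx_inj; rewrite root_eltE // scale0r addr0. Qed.

Lemma root_eltV i j t : i != j -> (root_elt i j t)^-1%g = root_elt i j (- t).
Proof.
by move=> ij; apply: (mulgI (root_elt i j t)); rewrite -root_eltD // subrr mulgV root_elt0.
Qed.

Lemma root_elt_unitri i j t : (i < j)%N -> root_elt i j t \in unitri 0.
Proof.
move=> ij; apply/unitri0P=> a b ba; rewrite root_elt_coefE; last first.
  by rewrite -(inj_eq val_inj) /= ltn_eqF.
case: andP => [[/eqP ai /eqP bj]|]; last by rewrite mulr0 addr0.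
by move: ba; rewrite ai bj leqNgt ij.
Qed.

Lemma root_elt_perm s i j t : i != j ->
  ((P s)^-1 * root_elt i j t * P s)%g = root_elt (s i) (s j) t.
Proof.
move=> ij; apply: GLmx_inj; apply/matrixP=> a b.
rewrite perm_conjVE !root_elt_coefE ?(inj_eq perm_inj) //.
by rewrite -!(can2_eq (permKV s) (permK s)).
Qed.

End Matrices.

#[local] Opaque unitri root_elt.

(** * The lattice as a module over the unitriangular group *)

(** The shape common to all rank one relations: y is fixed by x, s y is fixed by v,
   and the points s y, y, x s y = v y form a triangle. *)
Lemma three_term_ring (A : pzRingType) (e y s x v : A) :
  e = y - s * y -> x * y = y -> v * (s * y) = s * y -> x * (s * y) = v * y ->
  e - x * e = v * e.
Proof.
move=> -> xy vs xs; rewrite !mulrBr xy vs xs.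
by rewrite opprB addrC addrA subrK.
Qed.

Section Steinberg.
Variables (R : idomainType) (F : finFieldType) (m : nat).
Local Notation G := (GLn F m).
Local Notation RG := (group_algebra R G).
Local Notation B := (Borel F m).
Local Notation P := (@perm_elt F m).
Local Notation U := (unitri F m 0).
Local Notation delta := (@galg_elt R G).
Local Notation eps := (steinberg_gen R F m).
Local Notation Bhat := (galg_sum R B).
Implicit Types (g h u v b : G) (i j : 'I_m.+1) (s : 'S_m.+1) (x y : RG).

Lemma coset_eq g h : (g^-1 * h)%g \in B -> delta h * Bhat = delta g * Bhat.
Proof.
move=> gh; rewrite -[h in LHS](mulKVg g) galg_eltM -mulrA.
by rewrite (galg_elt_sum R (S := Borel_group F m)).
Qed.

Lemma perm_steinberg s : delta (P s) * eps = (-1) ^+ s * eps.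
Proof.
rewrite steinberg_genE !mulr_sumr [RHS](reindex_inj (mulgI s)) /=.
apply: eq_bigr => t _.
rewrite [RHS]mulrA -signr_addb odd_permM addKb perm_eltM galg_eltM.
by rewrite !mulrA commr_sign.
Qed.

Lemma fixes_cosets_steinberg g : (forall s, (P s^-1 * g * P s)%g \in B) ->
  delta g * eps = eps.
Proof.
move=> gB; rewrite steinberg_genE mulr_sumr; apply: eq_bigr => s _.
rewrite mulrA commr_sign -!mulrA; congr (_ * _); rewrite mulrA -galg_eltM.
by apply: coset_eq; rewrite -perm_eltV mulgA.
Qed.

(** In rank two, eps is the difference of the points oo and 0 of the projective line.
   Subtracting its translate by t leaves the difference of t and 0, which is
   again a translate of eps, by an element of the opposite root subgroup. *)
Lemma three_term i j t : i != j -> t != 0 ->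
  eps - delta (root_elt i j t) * eps = delta (root_elt j i t^-1) * eps.
Proof.
move=> ij t0; have ji : j != i by rewrite eq_sym.
pose tau := tperm i j.
pose A := \sum_(s : 'S_m.+1 | (s i < s j)%N) (-1) ^+ s * (delta (P s) * Bhat).
have epsE : eps = A - delta (P tau) * A.
  rewrite steinberg_genE (bigID (fun s : 'S_m.+1 => (s i < s j)%N)) /= -/A; congr (_ + _).
  rewrite mulr_sumr -sumrN (reindex_inj (mulgI tau)) /=.
  apply: eq_big => [s|s _].
    rewrite !permM tpermL tpermR -leqNgt leq_eqVlt orbC.
    by rewrite (inj_eq val_inj) (inj_eq perm_inj) (negPf ij) orbF.
  rewrite odd_permM odd_tperm ij signr_addb expr1 mulN1r mulNr; congr (- _).
  by rewrite perm_eltM galg_eltM !mulrA commr_sign.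
set x := root_elt i j t; set v := root_elt j i t^-1.
have stabA g h : (forall s, (s i < s j)%N -> ((h * P s)^-1 * (g * P s))%g \in B) ->
    delta g * A = delta h * A.
  move=> gh; rewrite !mulr_sumr; apply: eq_bigr => s /gh sB.
  rewrite !signAC; apply: congr1; rewrite !(mulrA (delta _) (delta _)) -!galg_eltM.
  exact: coset_eq.
have xA : delta x * A = A.
  rewrite (@stabA x 1%g) ?galg_elt1 ?mul1r // => s sij.
  by rewrite mul1g mulgA root_elt_perm //; apply/unitri_sub_Borel/root_elt_unitri.
have vsA : delta (v * P tau)%g * A = delta (P tau) * A.
  apply: stabA => s sij; rewrite -mulgA -perm_eltM.
  rewrite mulgA root_elt_perm // !permM tpermL tpermR.
  exact/unitri_sub_Borel/root_elt_unitri.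
have xsA : delta (x * P tau)%g * A = delta v * A.
  apply: stabA => s sij.
  rewrite invMg !mulgA -[((P s)^-1 * _ * _)%g]mulgA -[((P s)^-1 * _ * _)%g]mulgA.
  rewrite root_eltV //; apply/BorelP=> a b ba; rewrite perm_conjVE.
  set a' := (s^-1)%g a; set b' := (s^-1)%g b.
  have {ba} ab' : (s b' < s a')%N by rewrite !permKV.
  have ab : a' != b' by apply: contraTneq ab' => ->; rewrite ltnn.
  rewrite GLmxM mxE (bigD1 (tau b')) // big1 => [|k /= kb]; last first.
    by rewrite perm_elt_coefE (canF_eq (tpermK i j)) (negPf kb) mulr0.
  rewrite [LHS]addr0 perm_elt_coefE tpermK eqxx mulr1.
  rewrite GLmxM !root_eltE // mulmxDl mul1mx mulmxDr mulmx1 -scalemxAl -scalemxAr.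
  rewrite mul_delta_mx scalerA mulNr mulVf // scaleN1r !mxE.
  case: tpermP => [bi|bj|/eqP bi /eqP bj].
  - rewrite bi in ab; rewrite (negPf ab) (negPf ji) eqxx !andbF andbT !mulr0 addr0 add0r.
    by rewrite andbT subrr.
  - have ai : a' != i by apply: contraTneq ab' => ->; rewrite -leqNgt bj ltnW.
    by rewrite bj in ab; rewrite (negPf ab) (negPf ai) (negPf ij) !andbF !mulr0 subr0 !addr0.
  by rewrite (negPf ab) (negPf bi) (negPf bj) !andbF !mulr0 oppr0 !addr0.
by apply: (three_term_ring epsE xA); rewrite mulrA -galg_eltM.
Qed.

End Steinberg.

Section Span.
Variables (R : idomainType) (F : finFieldType) (m : nat).
Local Notation G := (GLn F m).
Local Notation RG := (group_algebra R G).
Local Notation B := (Borel F m).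
Local Notation P := (@perm_elt F m).
Local Notation U := (unitri F m 0).
Local Notation delta := (@galg_elt R G).
Local Notation eps := (steinberg_gen R F m).
Implicit Types (g h u v b : G) (i j : 'I_m.+1) (s : 'S_m.+1) (x y : RG).

Lemma borel_diagM b g i : b \in B -> g \in B ->
  GLmx (b * g)%g i i = GLmx b i i * GLmx g i i.
Proof.
move=> /BorelP bB /BorelP gB; rewrite GLmxM mxE (bigD1 i) //= big1 ?addr0 // => k ki.
have [lt_ki|le_ik] := ltnP k i; first by rewrite bB // mul0r.
by rewrite gB ?mulr0 // ltn_neqAle le_ik andbT eq_sym.
Qed.

Lemma borel_diag_neq0 b i : b \in B -> GLmx b i i != 0.
Proof.
move=> bB; have := borel_diagM i bB (groupVr bB).
rewrite mulgV GLmx1 mxE eqxx => /esym; apply: contra_eq_neq => ->.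
by rewrite mul0r eq_sym oner_eq0.
Qed.

Lemma diag_unitmx (d : 'rV[F]_m.+1) : (forall i, d 0 i != 0) -> diag_mx d \in unitmx.
Proof.
by move=> d0; rewrite unitmxE det_diag unitfE; apply/prodf_neq0 => i _.
Qed.

Lemma diag_steinberg g : (forall i j, i != j -> GLmx g i j = 0) -> delta g * eps = eps.
Proof.
move=> g0; apply: fixes_cosets_steinberg => s; apply/BorelP=> i j ji.
by rewrite perm_eltV perm_conjVE g0 // (inj_eq perm_inj) -val_eqE /= gtn_eqF.
Qed.

(** Diagonal matrices fix every coset w B, hence eps, so that only the unitriangular
   part of an upper triangular matrix acts. *)
Lemma borel_decomp b : b \in B ->
  exists2 u, u \in U & delta b * eps = delta u * eps.
Proof.
move=> bB; pose t := mkGL (diag_mx (\row_i GLmx b i i)).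
have tE : GLmx t = diag_mx (\row_i GLmx b i i).
  by apply/mkGLE/diag_unitmx => i; rewrite mxE borel_diag_neq0.
have tB : t \in B.
  by apply/BorelP=> i j ji; rewrite tE !mxE -(inj_eq val_inj) /= gtn_eqF.
have uB := groupM bB (groupVr tB).
exists (b * t^-1)%g.
  apply/unitri0P=> i j; rewrite leq_eqVlt => /orP[/eqP/val_inj->|ji]; last first.
    rewrite (BorelP _ uB) // -(inj_eq val_inj) /=.
    by rewrite gtn_eqF.
  have ti : GLmx t i i = GLmx b i i by rewrite tE !mxE eqxx.
  apply: (mulIf (borel_diag_neq0 i tB)); rewrite -borel_diagM // mulgKV eqxx mul1r.
  by rewrite ti.
have tfix : delta t * eps = eps.
  by apply: diag_steinberg => i j ij; rewrite tE !mxE (negPf ij).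
by rewrite -{2}tfix mulrA -galg_eltM mulgKV.
Qed.

Definition unitri_span x := exists2 r : RG, (forall g, g \notin U -> r g = 0) & x = r * eps.

Lemma unitri_span0 : unitri_span 0.
Proof. by exists 0 => [g _|]; rewrite ?ffunE ?mul0r. Qed.

Lemma unitri_spanD x y : unitri_span x -> unitri_span y -> unitri_span (x + y).
Proof.
move=> [r rU ->] [s sU ->]; exists (r + s) => [g gU|]; last by rewrite mulrDl.
by rewrite galg_DE rU // sU // addr0.
Qed.

Lemma unitri_span_scal a x : unitri_span x -> unitri_span (scal _ a * x).
Proof.
move=> [r rU ->]; exists (scal _ a * r) => [g gU|]; last by rewrite mulrA.
by rewrite scalE rU // mulr0.
Qed.

Lemma unitri_span_elt u x : u \in U -> unitri_span x -> unitri_span (delta u * x).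
Proof.
move=> uU [r rU ->]; exists (delta u * r) => [g gU|]; last by rewrite mulrA.
by rewrite galg_elt_mulE rU // groupMl ?groupV.
Qed.

Lemma unitri_span_sign (b : bool) x : unitri_span x -> unitri_span ((-1) ^+ b * x).
Proof. by move=> xU; rewrite -scal_sign; apply: unitri_span_scal. Qed.

Lemma unitri_span_eps : unitri_span eps.
Proof.
exists 1 => [g gU|]; last by rewrite mul1r.
by rewrite -galg_elt1 galg_eltE; case: eqP => // g1; rewrite g1 group1 in gU.
Qed.

Definition span_stable g := forall u, u \in U -> unitri_span (delta (g * u)%g * eps).

Lemma span_stable_mul g x : span_stable g -> unitri_span x -> unitri_span (delta g * x).
Proof.
move=> gS [r rU ->]; rewrite (galg_decomp r) mulr_suml mulr_sumr.
apply: (big_ind unitri_span) => [||h _]; [exact: unitri_span0|exact: unitri_spanD|].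
have [hU|hU] := boolP (h \in U); last first.
  have -> : scal G (r h) = 0 by rewrite rU //; apply/ffunP=> k; rewrite !ffunE mul0r.
  by rewrite !mul0r mulr0; exact: unitri_span0.
rewrite -(mulrA (scal _ _)) scalAC; apply: unitri_span_scal.
by rewrite mulrA -galg_eltM; apply: gS.
Qed.

Lemma span_stableM g h : span_stable g -> span_stable h -> span_stable (g * h)%g.
Proof.
move=> gS hS u uU; rewrite -mulgA galg_eltM -mulrA.
exact/span_stable_mul/hS.
Qed.

Lemma borel_span_stable b : b \in B -> span_stable b.
Proof.
move=> bB u uU; have buB := groupM bB (unitri_sub_Borel uU).
have [v vU ->] := borel_decomp buB; apply: unitri_span_elt => //.
exact: unitri_span_eps.
Qed.

(** Modulo the part of u that a simple reflection s keeps in U, only a root element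
   x remains.  If x = 1 then s eps = - eps; otherwise the three-term relation turns
   x eps into eps plus a term in the opposite root subgroup, which s brings back
   into U. *)
Lemma adjacent_tperm_span_stable i j : j = i.+1 :> nat -> span_stable (P (tperm i j)).
Proof.
move=> ji u uU; set tau := tperm i j; pose t := GLmx u i j.
have ij : i != j by rewrite -(inj_eq val_inj) /= ji; lia.
have lt_ij : (i < j)%N by rewrite ji.
(* u' has a zero entry at (i, j), so that the simple reflection keeps it in U *)
pose u' := (u * root_elt i j (- t))%g.
have u'U : u' \in U := groupM uU (root_elt_unitri _ lt_ij).
have u'ij : GLmx u' i j = 0.
  rewrite unitri_superdiagM ?root_elt_unitri // root_elt_coefE // (negPf ij).
  by rewrite !eqxx add0r mulr1 subrr.
have -> : (P tau * u = P tau * u' * (P tau)^-1 * (P tau * root_elt i j t))%g.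
  by rewrite -!mulgA mulKg -root_eltD // addNr root_elt0 // mulg1.
rewrite galg_eltM -mulrA; apply: unitri_span_elt.
  apply/unitri0P=> a b; rewrite perm_conjE => ba.
  have [/eqP->|ab] := boolP (a == b); first by rewrite (unitri0P _ u'U) // eqxx.
  have [le_ab|lt_ab] := leqP (tau b) (tau a).
    by rewrite (unitri0P _ u'U) // (inj_eq perm_inj) (negPf ab).
  have [aj bi] : a = j /\ b = i.
    move: lt_ab ba ab; rewrite /tau -val_eqE /= => lt_ab ba ab.
    split; apply: val_inj; move: lt_ab ba ab;
      case: tpermP => [->|->|+ +]; case: tpermP => [->|->|+ +];
      do ?[move=> /eqP; rewrite -val_eqE /= => ?]; rewrite /= ?ji; lia.
  by rewrite aj bi /tau tpermL tpermR u'ij.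
rewrite galg_eltM -mulrA; have [->|t0] := eqVneq t 0.
  rewrite root_elt0 // galg_elt1 mul1r perm_steinberg.
  exact/unitri_span_sign/unitri_span_eps.
have -> : delta (root_elt i j t) * eps = eps + scal _ (-1) * (delta (root_elt j i t^-1) * eps).
  by rewrite -(three_term _ ij t0) scalN scal1 mulN1r opprB addrC subrK.
rewrite mulrDr; apply: unitri_spanD.
  by rewrite perm_steinberg; apply/unitri_span_sign/unitri_span_eps.
rewrite mulrA -scalC -mulrA; apply: unitri_span_scal.
have -> : delta (P tau) * (delta (root_elt j i t^-1) * eps) =
    delta (root_elt i j t^-1) * (delta (P tau) * eps).
  have ji' : j != i by rewrite eq_sym.
  have <- : (P tau * root_elt j i (t^-1)%R * (P tau)^-1)%g = root_elt i j t^-1.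
    have PV : (P tau)^-1%g = P tau by rewrite -perm_eltV /tau tpermV.
    have := root_elt_perm tau t^-1 ji'; rewrite PV => ->.
    by rewrite /tau tpermL tpermR.
  by rewrite !mulrA -!galg_eltM mulgKV.
apply: unitri_span_elt; first exact: root_elt_unitri.
by rewrite perm_steinberg; apply/unitri_span_sign/unitri_span_eps.
Qed.

Lemma perm_span_stable s : span_stable (P s).
Proof.
have stab1 : span_stable 1%g.
  by move=> u uU; rewrite mul1g; apply/unitri_span_elt/unitri_span_eps.
have tpermS n : forall i j, j = (i + n)%N :> nat -> span_stable (P (tperm i j)).
  elim: n => [|n IHn] i j ij.
    have -> : j = i by apply: val_inj; rewrite /= ij addn0.
    by rewrite tperm1 perm_elt1.
  have ltk : (i + n < m.+1)%N by apply: leq_ltn_trans (ltn_ord j); rewrite ij addnS.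
  pose k := Ordinal ltk.
  have jk : j = k.+1 :> nat by rewrite ij addnS.
  have [ik|ki] := eqVneq k i; first by apply: adjacent_tperm_span_stable; rewrite -ik.
  have ji : j != i by rewrite -val_eqE /= ij; lia.
  have -> : tperm i j = (tperm k j * tperm i k * tperm k j)%g.
    by rewrite -{1}[tperm k j]tpermV -mulgA -conjgE tpermJ tpermL tpermD.
  have kS := adjacent_tperm_span_stable jk.
  by rewrite !perm_eltM; apply/span_stableM/kS/span_stableM; [exact: kS | exact: IHn].
have [ts -> _] := prod_tpermP s; elim: ts => [|[i j] ts IHts].
  by rewrite big_nil perm_elt1.
rewrite big_cons perm_eltM; apply: span_stableM; last exact: IHts.
have [le_ij|lt_ji] := leqP i j; first by apply: (tpermS (j - i)%N); rewrite subnKC.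
by rewrite tpermC; apply: (tpermS (i - j)%N); rewrite subnKC // ltnW.
Qed.

Definition rev_perm : 'S_m.+1 := perm rev_ord_inj.

(** LUP decomposition writes g as a permutation, times a lower unitriangular matrix,
   times an upper triangular one, and the lower unitriangular matrices are the
   conjugates of U by the longest permutation. *)
Lemma span_stableT g : span_stable g.
Proof.
have revK : (rev_perm * rev_perm = 1)%g.
  by apply/permP=> i; rewrite permM !permE rev_ordK.
have := cormen_lup_correct (GLmx g); have := cormen_lup_perm (GLmx g).
have := cormen_lup_lower (GLmx g); have := cormen_lup_upper (GLmx g).
case: (cormen_lup _) => [[Q L] C] /= Cup Llow /is_perm_mxP[s ->] LUP.
have detL : \det L = 1.
  rewrite det_trig; first by rewrite big1 // => i _; rewrite Llow // eqxx.
  apply/is_trig_mxP => i j ij; rewrite Llow ?(ltnW ij) //.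
  by rewrite -val_eqE /= ltn_eqF.
have uL : L \in unitmx by rewrite unitmxE detL unitr1.
have uC : C \in unitmx.
  have : perm_mx s * GLmx g \in unitmx.
    by rewrite -mulmxE unitmx_mul unitmx_perm andTb; exact: (GLmx_unit g).
  by rewrite LUP -mulmxE unitmx_mul => /andP[].
pose b := mkGL C; pose v := mkGL L.
have bB : b \in B by apply/BorelP=> i j ji; rewrite mkGLE // Cup.
have vU : (P rev_perm * v * (P rev_perm)^-1)%g \in U.
  apply/unitri0P=> i j ji; rewrite perm_conjE mkGLE // !permE Llow.
    by rewrite (inj_eq rev_ord_inj).
  by rewrite /= leq_sub2l.
have -> : g = (P s^-1 * (P rev_perm * (P rev_perm * v * (P rev_perm)^-1) * P rev_perm) * b)%g.
  rewrite !mulgA -!perm_eltM mulgKV -(mulgA s^-1%g) revK mulg1 perm_eltV -mulgA.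
  apply: (canRL (mulKg _)); apply: GLmx_inj.
  by rewrite !GLmxM !mkGLE // perm_eltE.
apply: span_stableM (borel_span_stable bB).
apply: span_stableM (perm_span_stable _) _.
apply: span_stableM (perm_span_stable _).
apply: span_stableM (perm_span_stable _) _.
exact: borel_span_stable (unitri_sub_Borel vU).
Qed.

Theorem steinberg_unitri_span a : unitri_span (a * eps).
Proof.
rewrite (galg_decomp a) mulr_suml.
apply: (big_ind unitri_span) => [||g _]; [exact: unitri_span0|exact: unitri_spanD|].
rewrite -mulrA; apply: unitri_span_scal; rewrite -[g]mulg1.
exact/span_stableT/group1.
Qed.

End Span.

(** * Whittaker elements *)

Lemma decreasing_perm m (s : 'S_m.+1) :
  (forall i j : 'I_m.+1, j = i.+1 :> nat -> (s j < s i)%N) -> s = rev_perm m.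
Proof.
move=> sD; apply/permP=> i; apply: val_inj; rewrite permE /= subSS.
have ub k : forall i : 'I_m.+1, i = k :> nat -> (s i <= m - k)%N.
  elim: k => [|k IHk] j jk; first by rewrite subn0 -ltnS.
  have ltk : (k < m.+1)%N by apply: leq_ltn_trans (ltn_ord j); rewrite jk.
  have := sD (Ordinal ltk) j jk; have := IHk (Ordinal ltk) erefl; lia.
have lb k : forall i : 'I_m.+1, (i + k)%N = m -> (k <= s i)%N.
  elim: k => [|k IHk] // j jk.
  have ltj : (j.+1 < m.+1)%N by lia.
  apply: leq_ltn_trans (sD j (Ordinal ltj) erefl); apply: IHk => /=; lia.
apply/eqP; rewrite eqn_leq ub //= lb // subnKC // -ltnS.
exact: ltn_ord.
Qed.

Section WhittakerElement.
Variables (R : idomainType) (F : finFieldType) (m : nat) (psi : F -> R).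
Local Notation RG := (group_algebra R (GLn F m)).

(** For k = 0 this is |U| times the idempotent of the linear character
   u |-> psi (tr (D u)) of U; larger values of k restrict it to [unitri k]. *)
Definition whittaker (k : nat) D : RG :=
  [ffun h => (h \in unitri F m k)%:R * psi (- \tr (D *m GLmx h))].

Lemma whittakerE k D h :
  whittaker k D h = (h \in unitri F m k)%:R * psi (- \tr (D *m GLmx h)).
Proof. exact: ffunE. Qed.

End WhittakerElement.

#[local] Opaque whittaker.

Section Whittaker.
Variables (R : idomainType) (F : finFieldType) (m : nat) (psi : F -> R).
Hypothesis psiP : additive_character psi.
Local Notation G := (GLn F m).
Local Notation RG := (group_algebra R G).
Local Notation B := (Borel F m).
Local Notation P := (@perm_elt F m).
Local Notation U := (unitri F m 0).
Local Notation delta := (@galg_elt R G).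
Local Notation eps := (steinberg_gen R F m).
Local Notation Bhat := (galg_sum R B).
Local Notation scal := (@scal R G).
Local Notation whittaker := (@whittaker R F m psi).
Implicit Types (g h u v b : G) (i j : 'I_m.+1) (s : 'S_m.+1) (x y : RG) (D : 'M[F]_m.+1).

Lemma addcharD : {morph psi : a b / a + b >-> a * b}. Proof. by case: psiP. Qed.
Lemma addchar0 : psi 0 = 1. Proof. by case: psiP. Qed.
Lemma addcharVl t : psi (- t) * psi t = 1.
Proof. by rewrite -addcharD addNr addchar0. Qed.

Lemma whittaker_elt D u : subdiag D -> u \in U ->
  whittaker 0 D * delta u = scal (psi (\tr (D *m GLmx u))) * whittaker 0 D.
Proof.
move=> sD uU; apply/ffunP=> h; rewrite scalE galg_mul_eltE !whittakerE.
rewrite groupMr ?groupV //; have [hU|] := boolP (h \in U); last by rewrite !mul0r mulr0.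
by rewrite subdiag_trM ?groupV // subdiag_trV // opprD opprK addcharD !mul1r mulrC.
Qed.

(** Each linear character of U occurs at most once in I, since I = RU eps. *)
Lemma whittaker_steinberg D a : subdiag D ->
  exists c, whittaker 0 D * (a * eps) = scal c * (whittaker 0 D * eps).
Proof.
move=> sD; have [r rU ->] := steinberg_unitri_span a.
suff [c E] : exists c, whittaker 0 D * r = scal c * whittaker 0 D.
  by exists c; rewrite mulrA E mulrA.
rewrite (galg_decomp r) mulr_sumr.
apply: (big_ind (fun x => exists c, x = scal c * whittaker 0 D)) => [|x y [c ->] [d ->]|u _].
- by exists 0; apply/ffunP=> g; rewrite scalE mul0r ffunE.
- by exists (c + d); rewrite scalD mulrDl.
rewrite scalAC; have [uU|uU] := boolP (u \in U).
  by exists (r u * psi (\tr (D *m GLmx u))); rewrite whittaker_elt // scalM mulrA.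
by exists 0; apply/ffunP=> g; rewrite (rU _ uU) !scalE !mul0r.
Qed.

(** A permutation s other than the longest one has an ascent i, i+1.  The coset s B
   is then fixed by the root subgroup of (i, i+1), on which the character of a generic
   D is nontrivial, so that the term of s in eps is killed. *)
Lemma whittaker_nondeg D : generic_subdiag D ->
  whittaker 0 D * eps = (-1) ^+ rev_perm m * (whittaker 0 D * (delta (P (rev_perm m)) * Bhat)).
Proof.
move=> [sD nD]; rewrite steinberg_genE mulr_sumr (bigD1 (rev_perm m)) //= big1 ?addr0.
  exact: signAC.
move=> s sr.
have /existsP[i /existsP[j /andP[/eqP ji sij]]] :
    [exists i : 'I_m.+1, exists j : 'I_m.+1, (j == i.+1 :> nat) && (s i < s j)%N].
  apply: contraNT sr => /existsPn noij; apply/eqP/decreasing_perm => i j ji.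
  have := noij i => /existsPn/(_ j); rewrite ji eqxx /= -leqNgt leq_eqVlt => /orP[|//].
  rewrite (inj_eq (inj_comp val_inj (@perm_inj _ s))) => /eqP ij.
  by move: ji; rewrite ij => /eqP; rewrite ltn_eqF.
have neq_ij : i != j by rewrite -val_eqE /= ji; lia.
have [_ _ [t0 t0P]] := psiP.
(* the parameter is chosen so that the character of D takes the value psi t0 <> 1 at x *)
pose x := root_elt i j ((D j i)^-1 * t0).
have xU : x \in U by apply: root_elt_unitri; rewrite ji.
have xB : delta x * (delta (P s) * Bhat) = delta (P s) * Bhat.
  rewrite mulrA -galg_eltM; apply: coset_eq.
  by rewrite mulgA root_elt_perm //; apply/unitri_sub_Borel/root_elt_unitri.
have trx : \tr (D *m GLmx x) = t0.
  rewrite mxtrace_mulE (bigD1 j) //= (bigD1 i) //= root_elt_coefE // (negPf neq_ij) !eqxx.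
  rewrite add0r mulr1 mulrA mulfV ?mul1r ?nD // !big1 ?addr0 // => [b bj|a ai].
    rewrite big1 // => a _; have [ab|ab] := eqVneq (b : nat) a.+1; last by rewrite sD // mul0r.
    rewrite root_elt_coefE // (negPf bj) andbF mulr0 addr0 -val_eqE /= ab.
    by rewrite ltn_eqF ?mulr0.
  by rewrite sD ?mul0r // ji eqSS eq_sym val_eqE.
have : scal (psi t0 - 1) * (whittaker 0 D * (delta (P s) * Bhat)) = 0.
  have := congr1 ( *%R^~ (delta (P s) * Bhat)) (whittaker_elt sD xU).
  rewrite /= -!mulrA xB trx => E.
  by rewrite scalD scalN scal1 mulrBl mul1r -E subrr.
move=> E; rewrite signAC (_ : whittaker 0 D * _ = 0) ?mulr0 //.
apply/ffunP=> g; have /ffunP/(_ g)/eqP := E.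
by rewrite scalE [X in _ == X]ffunE mulf_eq0 subr_eq0 (negPf t0P) => /eqP->; rewrite ffunE.
Qed.

(** The elements of U form a transversal of the cosets in the big cell. *)
Lemma whittaker_nondegE D u b : generic_subdiag D -> u \in U -> b \in B ->
  (whittaker 0 D * eps) (u * P (rev_perm m) * b)%g = (-1) ^+ rev_perm m * psi (- \tr (D *m GLmx u)).
Proof.
move=> nD uU bB; rewrite whittaker_nondeg // -scal_sign scalE; congr (_ * _).
rewrite galg_ME (bigD1 u) //= big1 ?addr0 => [|v vu].
  by rewrite galg_elt_mulE galg_sum_coefE -!mulgA !mulKg bB mulr1 whittakerE uU mul1r.
rewrite galg_elt_mulE galg_sum_coefE whittakerE.
have [vU|] := boolP (v \in U); last by rewrite !mul0r.
rewrite !mulgA groupMr //.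
rewrite -[(_ * v^-1 * u)%g]mulgA; case: (boolP (_ \in B)) => [cB|]; last by rewrite mulr0.
have cU : (v^-1 * u)%g \in U by rewrite groupM ?groupV.
case/eqP: vu; apply: (mulgI v^-1%g); rewrite mulVg; apply: GLmx_inj; apply/matrixP=> i j.
rewrite GLmx1 mxE; have [le_ji|lt_ij] := leqP j i; first exact/esym/(unitri0P _ cU).
rewrite -val_eqE /= ltn_eqF //.
have := BorelP _ cB (rev_perm m i) (rev_perm m j).
rewrite perm_conjVE !permK !permE /= ltn_sub2lE ?ltn_ord // => ->; first by [].
by have := ltn_ord j; lia.
Qed.

End Whittaker.

(** * Reaching the degenerate characters *)

(** The longest element of a Young subgroup: it keeps the blocks in order and
   reverses each of them.  It is obtained by ranking the indices along a key that
   increases with the block and decreases inside a block. *)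
Lemma block_reversal m (blk : nat -> nat) :
    (forall i j, (i <= j)%N -> (blk i <= blk j)%N) ->
  exists t : 'S_m.+1,
    (forall a b : 'I_m.+1, (a <= b)%N -> (blk (t a) <= blk (t b))%N) /\
    (forall a b : 'I_m.+1, (a < b)%N -> blk (t a) = blk (t b) -> (t b < t a)%N).
Proof.
move=> blk_mono; pose key (i : 'I_m.+1) := (blk i * m.+1 + (m - i))%N.
have keyP (i j : 'I_m.+1) :
    ((blk i < blk j)%N \/ blk i = blk j /\ (j < i)%N) -> (key i < key j)%N.
  have [] := (ltn_ord i, ltn_ord j); rewrite /key => im jm [lt_ij|[-> ji]]; last lia.
  have : ((blk i).+1 * m.+1 <= blk j * m.+1)%N by rewrite leq_mul2r lt_ij orbT.
  by rewrite mulSn; lia.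
pose below i := [set j | (key j < key i)%N].
have below_lt i : (#|below i| < m.+1)%N.
  rewrite -[X in (_ < X)%N]card_ord -cardsT; apply/proper_card/properP; split.
    exact: subsetT.
  by exists i; rewrite // inE ltnn.
pose s i := Ordinal (below_lt i).
have s_mono i j : (key i < key j)%N -> (s i < s j)%N.
  move=> ij; apply/proper_card/properP; split.
    by apply/subsetP=> k; rewrite !inE => /ltn_trans; apply.
  by exists i; rewrite !inE ?ltnn.
have key_lt i j : i != j -> (key i < key j)%N \/ (key j < key i)%N.
  rewrite -val_eqE /= neq_ltn => ij.
  have [lt_b|lt_b|eq_b] := ltngtP (blk i) (blk j).
  - by left; apply: keyP; left.
  - by right; apply: keyP; left.
  by case/orP: ij => ij; [right | left]; apply: keyP; right.
have s_inj : injective s.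
  move=> i j ij; apply/eqP; apply: contraT => /key_lt[] /s_mono; rewrite ij ltnn //.
exists (perm s_inj)^-1%g; set t := (_^-1)%g.
have tK a : s (t a) = a by rewrite -[RHS](permKV (perm s_inj) a) permE.
split=> a b ab.
  rewrite leqNgt; apply/negP=> lt_ba.
  have /s_mono : (key (t b) < key (t a))%N by apply: keyP; left.
  by rewrite !tK ltnNge ab.
move=> eq_ab; rewrite ltnNge; apply/negP; rewrite leq_eqVlt => /orP[/eqP/val_inj/perm_inj E|lt_ab].
  by rewrite E ltnn in ab.
have /s_mono : (key (t b) < key (t a))%N by apply: keyP; right.
by rewrite !tK ltnNge ltnW.
Qed.

Section BlockDiagonal.
Variables (F : finFieldType) (m : nat) (c : 'I_m.+1 -> nat).
Local Notation G := (GLn F m).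

Definition block_diag : {set G} :=
  [set g : G | [forall a : 'I_m.+1, forall b : 'I_m.+1, (c a == c b) || (GLmx g a b == 0)]].

Lemma block_diagP (g : G) :
  reflect (forall a b, c a != c b -> GLmx g a b = 0) (g \in block_diag).
Proof.
rewrite inE; apply: (iffP forallP) => [gD a b /negPf ab | gD a].
  by move/forallP/(_ b): (gD a); rewrite ab => /eqP.
apply/forallP=> b; case: (boolP (c a == c b)) => //= ab.
by rewrite gD.
Qed.

Lemma block_diag_group_set : group_set block_diag.
Proof.
apply/group_setP; split=> [|g h /block_diagP gD /block_diagP hD]; apply/block_diagP=> a b ab.
  by rewrite GLmx1 mxE (_ : (a == b) = false) //; apply: contraNF ab => /eqP->.
rewrite GLmxM mxE big1 // => k _; have [ak|ak] := eqVneq (c a) (c k).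
  by rewrite hD ?mulr0 // -ak.
by rewrite gD ?mul0r.
Qed.
Canonical block_diag_group := Group block_diag_group_set.

(** The block diagonal part v of y is its lower triangular part; it is invertible and
   preserves the blocks, while the rest of y strictly increases them, so v^-1 y is
   upper triangular. *)
Lemma lower_Borel_decomp (y : G) :
    (forall a b : 'I_m.+1, (a <= b)%N -> (c a <= c b)%N) ->
    (forall a, GLmx y a a = 1) ->
    (forall a b : 'I_m.+1, (b < a)%N -> GLmx y a b != 0 -> c a = c b) ->
    (forall a b : 'I_m.+1, (a < b)%N -> GLmx y a b != 0 -> (c a < c b)%N) ->
  exists v b : G, [/\ y = (v * b)%g, b \in Borel F m &
    forall i j, GLmx v i j = if (j <= i)%N then GLmx y i j else 0].
Proof.
move=> c_mono y1 ylow yup.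
pose L := \matrix_(i, j) if (j <= i)%N then GLmx y i j else 0.
have uL : L \in unitmx.
  rewrite unitmxE det_trig; first by rewrite big1 ?unitr1 // => i _; rewrite mxE leqnn.
  by apply/is_trig_mxP => i j ij; rewrite mxE leqNgt ij.
pose v : G := mkGL L; have vE : GLmx v = L by rewrite mkGLE.
have vD : v \in block_diag.
  apply/block_diagP=> a b; rewrite vE mxE; case: leqP => // le_ba.
  have [->|ab] := eqVneq a b; first by rewrite eqxx.
  have lt_ba : (b < a)%N by rewrite ltn_neqAle le_ba andbT eq_sym.
  by apply: contraNeq => /(ylow _ _ lt_ba)->.
exists v, (v^-1 * y)%g; split=> [||i j]; last by rewrite vE mxE.
  by rewrite mulKVg.
apply/BorelP=> a b lt_ba; have yE : GLmx y = L + (GLmx y - L) by rewrite addrC subrK.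
rewrite GLmxM yE mulmxDr -vE -GLmxM mulVg GLmx1 !mxE -val_eqE /= gtn_eqF // add0r.
rewrite big1 // => k _; have [ak|ak] := eqVneq (c a) (c k); last first.
  by rewrite (block_diagP _ (groupVr vD)) ?mul0r.
rewrite [X in _ * X]mxE vE !mxE; case: leqP => [_|lt_kb]; first by rewrite subrr mulr0.
rewrite subr0; have [->|/(yup _ _ lt_kb)] := eqVneq (GLmx y k b) 0; first by rewrite mulr0.
by rewrite -ak ltnNge c_mono // ltnW.
Qed.

End BlockDiagonal.

Section Levi.
Variables (F : finFieldType) (m : nat) (D : 'M[F]_m.+1).
Implicit Types i j a b : 'I_m.+1.

(** Two consecutive indices share a block exactly when the entry of D that couples
   them does not vanish: the blocks are those of the Levi subgroup on which the
   character of D is generic. *)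
Definition block_index (k : nat) : nat :=
  #|[set i : 'I_m.+1 | (i < k)%N & [exists j : 'I_m.+1, (j == i.+1 :> nat) && (D j i == 0)]]|.

Lemma block_index_mono k k' : (k <= k')%N -> (block_index k <= block_index k')%N.
Proof.
move=> kk'; apply/subset_leq_card/subsetP=> i; rewrite !inE => /andP[ik ->].
by rewrite (leq_trans ik).
Qed.

Lemma block_index_step i j : j = i.+1 :> nat ->
  (block_index i == block_index j) = (D j i != 0).
Proof.
move=> ji; set brk := fun i : 'I_m.+1 => [exists j : 'I_m.+1, (j == i.+1 :> nat) && (D j i == 0)].
have brk_i : brk i = (D j i == 0).
  apply/existsP/idP => [[k /andP[/eqP ki Dk]]|Dj]; last by exists j; rewrite ji eqxx.
  by have -> : j = k by apply: val_inj; rewrite /= ji ki.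
have [D0|D0] := eqVneq (D j i) 0; last first.
  apply/eqP; rewrite /block_index; apply: eq_card => k; rewrite !inE -/(brk k) ji ltnS.
  rewrite [in RHS]leq_eqVlt; case: eqVneq => [/ord_inj->|] //=.
  by rewrite brk_i (negPf D0) andbF.
apply/negbTE; rewrite neq_ltn; apply/orP; left; apply/proper_card/properP; split.
  apply/subsetP=> k; rewrite !inE => /andP[ki ->].
  by rewrite ji ltnS ltnW.
by exists i; rewrite !inE -/(brk i) brk_i ?D0 ?eqxx ?ji ?ltnS ?leqnn ?ltnn.
Qed.

Variable t : 'S_m.+1.
Hypothesis t_mono : forall a b, (a <= b)%N -> (block_index (t a) <= block_index (t b))%N.
Hypothesis t_rev : forall a b,
  (a < b)%N -> block_index (t a) = block_index (t b) -> (t b < t a)%N.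

Lemma reversal_adjacent_pos a b : t a = (t b).+1 :> nat -> D (t a) (t b) != 0 ->
  b = a.+1 :> nat /\ block_index (t a) = block_index (t b).
Proof.
move=> ab; rewrite -(block_index_step ab) => /eqP eq_blk; split=> //.
have lt_ab : (a < b)%N.
  rewrite ltnNge leq_eqVlt; apply/negP=> /orP[/eqP/val_inj E|lt_ba].
    by move: ab; rewrite E; lia.
  by have := t_rev lt_ba eq_blk; rewrite ab; lia.
apply/eqP; rewrite eqn_leq lt_ab andbT leqNgt; apply/negP=> lt_acb.
have ltc : (a.+1 < m.+1)%N by apply: ltn_trans lt_acb _.
pose c := Ordinal ltc.
have [ac cb] : (a < c)%N /\ (c < b)%N by rewrite /=; split; lia.
have := t_mono (ltnW ac); have := t_mono (ltnW cb) => cb_blk ac_blk.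
have eq_c : block_index (t a) = block_index (t c) by lia.
have := t_rev ac eq_c; have /(t_rev cb) : block_index (t c) = block_index (t b) by lia.
by rewrite ab; lia.
Qed.

Lemma reversal_adjacent_val a b : b = a.+1 :> nat ->
  block_index (t a) = block_index (t b) -> t a = (t b).+1 :> nat.
Proof.
move=> ab eq_blk; have lt_ab : (a < b)%N by rewrite ab.
have lt_t := t_rev lt_ab eq_blk.
apply/eqP; rewrite eqn_leq lt_t andbT leqNgt; apply/negP=> lt_ta.
have ltk : ((t b).+1 < m.+1)%N by apply: ltn_trans lt_ta _.
pose c := (t^-1)%g (Ordinal ltk).
have tc : t c = (t b).+1 :> nat by rewrite permKV.
have [blk1 blk2] : (block_index (t b) <= block_index (t c) /\
    block_index (t c) <= block_index (t a))%N.
  by split; apply: block_index_mono; rewrite tc.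
have [ca|ca] : (c <= a)%N \/ (b <= c)%N by rewrite ab; lia.
  have ca' : (c < a)%N.
    rewrite ltn_neqAle ca andbT; apply: contraTneq lt_ta => /val_inj <-.
    by rewrite tc ltnn.
  have /(t_rev ca') : block_index (t c) = block_index (t a) by lia.
  by rewrite tc; lia.
have bc : (b < c)%N.
  rewrite ltn_neqAle ca andbT; apply/eqP=> /val_inj bc.
  by move: tc; rewrite bc; lia.
have /(t_rev bc) : block_index (t b) = block_index (t c) by lia.
by rewrite tc; lia.
Qed.

(** Conjugating D by the block reversal makes its nonzero entries superdiagonal; ones
   are put in the remaining places to make the matrix generic. *)
Definition block_twist : 'M[F]_m.+1 :=
  \matrix_(a, b) if b == a.+1 :> nat then
    if block_index (t a) == block_index (t b) then D (t a) (t b) else 1 else 0.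

End Levi.

Section Descent.
Variables (R : idomainType) (F : finFieldType) (m : nat) (psi : F -> R).
Hypothesis psiP : additive_character psi.
Local Notation G := (GLn F m).
Local Notation RG := (group_algebra R G).
Local Notation B := (Borel F m).
Local Notation P := (@perm_elt F m).
Local Notation U := (unitri F m 0).
Local Notation delta := (@galg_elt R G).
Local Notation eps := (steinberg_gen R F m).
Local Notation scal := (@scal R G).
Local Notation whittaker := (@whittaker R F m psi).
Implicit Types (g h u v : G) (D : 'M[F]_m.+1).

(** The scalar c is found by evaluating both sides at the block reversal w.  For u
   in U, the element w^-1 u^-1 w has a block diagonal lower part and a remainder
   in B, so the arguments at which W_D' eps is evaluated all lie in the big cell,
   where its value cancels the character of D at u.  The sum is then |U| up to
   sign. *)
Lemma whittaker_degenerate D : subdiag D ->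
  exists D' g c d, [/\ generic_subdiag D',
    whittaker 0 D * (delta g * (whittaker 0 D' * eps)) = scal c * (whittaker 0 D * eps) &
    c * d = #|U|%:R].
Proof.
move=> sD; have [t [t_mono t_rev]] := @block_reversal m (block_index D) (block_index_mono D).
pose blk a := block_index D (t a).
(* conjugation by the longest permutation turns superdiagonal matrices into subdiagonal ones *)
pose D2 := block_twist D t; pose rev := rev_perm m.
pose D' : 'M[F]_m.+1 := \matrix_(a, b) D2 (rev a) (rev b).
have gD' : generic_subdiag D'.
  have rev_step (a b : 'I_m.+1) : (rev b == (rev a).+1 :> nat) = (a == b.+1 :> nat).
    by rewrite !permE /=; have := ltn_ord a; have := ltn_ord b; lia.
  split=> a b ab; rewrite !mxE rev_step; first by rewrite (negPf ab).
  rewrite ab eqxx; case: ifP => [eq_blk|_]; last exact: oner_neq0.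
  have ab' : rev b = (rev a).+1 :> nat by apply/eqP; rewrite rev_step ab.
  have ta := reversal_adjacent_val t_rev ab' (eqP eq_blk).
  by rewrite -(block_index_step D ta) eq_sym.
pose g := ((P t)^-1 * (P rev)^-1)%g; pose w := (P t)^-1%g.
pose sgn : R := (-1) ^+ rev.
have [c cE] := whittaker_steinberg psiP (delta g * whittaker 0 D') sD.
exists D', g, c, (sgn * (whittaker 0 D * eps) w); split=> //; first by rewrite mulrA -cE !mulrA.
have : (whittaker 0 D * (delta g * whittaker 0 D' * eps)) w = sgn * #|U|%:R.
  rewrite galg_ME (bigID (mem U)) /= [X in _ + X]big1 ?addr0 => [|u uU]; last first.
    by rewrite whittakerE (negPf uU) !mul0r.
  rewrite (eq_bigr (fun=> sgn)) => [|u uU].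
    by rewrite sumr_const mulr_natr.
  rewrite whittakerE uU mul1r -mulrA galg_elt_mulE.
  pose y := (P t * u^-1 * (P t)^-1)%g.
  have uVU : u^-1%g \in U by rewrite groupV.
  have yE a b : GLmx y a b = GLmx u^-1%g (t a) (t b) by rewrite perm_conjE.
  have y_nz a b : a != b -> GLmx y a b != 0 -> (t a < t b)%N.
    move=> ab; rewrite yE ltnNge; apply: contraNN => le_ba.
    by rewrite (unitri0P _ uVU) // (inj_eq perm_inj) (negPf ab).
  have [| | |y' [b [yb bB y'E]]] := @lower_Borel_decomp F m blk y t_mono.
  - by move=> a; rewrite yE (unitri0P _ uVU) // eqxx.
  - move=> a b lt_ba /y_nz; rewrite -val_eqE /= gtn_eqF // => /(_ isT) lt_t.
    apply/eqP; rewrite eqn_leq; apply/andP; split; last exact: t_mono (ltnW lt_ba).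
    exact: block_index_mono (ltnW lt_t).
  - move=> a b lt_ab /y_nz; rewrite -val_eqE /= ltn_eqF // => /(_ isT) lt_t.
    rewrite ltn_neqAle; apply/andP; split; last exact: block_index_mono (ltnW lt_t).
    by apply/eqP=> /(t_rev _ _ lt_ab); rewrite ltnNge ltnW.
  pose u0 := (P rev * y' * (P rev)^-1)%g.
  have u0U : u0 \in U.
    apply/unitri0P=> i j ji; rewrite perm_conjE y'E.
    have rev_le : (rev i <= rev j)%N by rewrite !permE /=; lia.
    case: leqP => [le_ji|lt_ij].
      have -> : i = j by apply/(@perm_inj _ rev)/val_inj/eqP; rewrite eqn_leq rev_le.
      by rewrite yE (unitri0P _ uVU) // !eqxx.
    by case: eqVneq rev_le lt_ij => // ->; rewrite ltnn.
  have -> : (g^-1 * (u^-1 * w) = u0 * P rev * b)%g.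
    rewrite /u0 mulgKV -mulgA -yb /g invMg !invgK /y /w.
    by rewrite !mulgA.
  rewrite whittaker_nondegE //.
  suff -> : \tr (D' *m GLmx u0) = - \tr (D *m GLmx u).
    by rewrite opprK mulrCA addcharVl // mulr1.
  rewrite -subdiag_trV // !mxtrace_mulE (reindex_inj (@perm_inj _ rev^-1%g)) /=.
  rewrite [RHS](reindex_inj (@perm_inj _ t)) /=; apply: eq_bigr => a _.
  rewrite (reindex_inj (@perm_inj _ rev^-1%g)) [RHS](reindex_inj (@perm_inj _ t)) /=.
  apply: eq_bigr => b' _; rewrite perm_conjE y'E [D' _ _]mxE !permKV [D2 _ _]mxE yE.
  have [ab|ab] := eqVneq (b' : nat) a.+1.
    have lt_ab : (a < b')%N by rewrite ab.
    rewrite ltnW //; case: ifP => [//|neq_blk].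
    have [->|Dn] := eqVneq (D (t a) (t b')) 0.
      rewrite mul0r mul1r -yE; apply/eqP; apply: contraFT neq_blk.
      move=> /y_nz; rewrite -val_eqE /= gtn_eqF // => /(_ isT) lt_t.
      by rewrite eqn_leq t_mono ?(ltnW lt_ab) // block_index_mono // ltnW.
    have tab : t a = (t b').+1 :> nat by apply/eqP; apply: contraNT Dn => /sD->.
    by have [_ E] := reversal_adjacent_pos t_mono t_rev tab Dn; rewrite E eqxx in neq_blk.
  rewrite mul0r; have [->|Dn] := eqVneq (D (t a) (t b')) 0; first by rewrite mul0r.
  have tab : t a = (t b').+1 :> nat by apply/eqP; apply: contraNT Dn => /sD->.
  by have [E] := reversal_adjacent_pos t_mono t_rev tab Dn; rewrite E eqxx in ab.
rewrite cE scalE => E; rewrite mulrCA E mulrA /sgn -signr_addb addbb mul1r //.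
Qed.

End Descent.

(** * From linear characters to the whole lattice *)

Section CornerGroup.
Variables (F : finFieldType) (m k : nat).
Local Notation G := (GLn F m).
Implicit Types (g h : G) (i j : 'I_m.+1).

(** The upper left copy of GL_k, which normalises [unitri k] and acts linearly on
   its column k. *)
Definition corner : {set G} :=
  [set g : G | [forall i : 'I_m.+1, forall j : 'I_m.+1,
     (i < k)%N && (j < k)%N || (GLmx g i j == (i == j)%:R)]].

Lemma cornerP g :
  reflect (forall i j, ~~ ((i < k)%N && (j < k)%N) -> GLmx g i j = (i == j)%:R) (g \in corner).
Proof.
rewrite inE; apply: (iffP forallP) => [gC i j /negPf ij | gC i].
  by move/forallP/(_ j): (gC i); rewrite ij => /eqP.
by apply/forallP=> j; case: (boolP (_ && _)) => //= ij; rewrite gC.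
Qed.

Lemma corner_group_set : group_set corner.
Proof.
apply/group_setP; split=> [|g h /cornerP gC /cornerP hC]; apply/cornerP=> i j ij.
  by rewrite GLmx1 mxE.
rewrite GLmxM mxE; have [lt_ik|le_ki] := ltnP i k.
  have jk : ~~ (j < k)%N by rewrite lt_ik in ij.
  rewrite (bigD1 j) //= hC ?(negPf jk) ?andbF // eqxx mulr1 gC // big1 ?addr0 // => l lj.
  by rewrite hC ?(negPf jk) ?andbF // (negPf lj) mulr0.
have ik : ~~ (i < k)%N by rewrite -leqNgt.
rewrite (bigD1 i) //= gC ?(negPf ik) // eqxx mul1r hC // big1 ?addr0 // => l li.
by rewrite gC ?(negPf ik) // eq_sym (negPf li) mul0r.
Qed.
Canonical corner_group := Group corner_group_set.

Lemma corner_mulmx_id (D : 'M[F]_m.+1) g : g \in corner ->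
  (forall i j, (i < k)%N -> D i j = 0) -> GLmx g *m D = D.
Proof.
move=> /cornerP gC D0; apply/matrixP=> i j; rewrite mxE.
have [lt_ik|le_ki] := ltnP i k.
  rewrite D0 // big1 // => l _; have [lt_lk|le_kl] := ltnP l k; first by rewrite D0 ?mulr0.
  rewrite gC ?(ltnNge l) ?le_kl ?andbF // -val_eqE /= ltn_eqF ?mul0r //.
  exact: leq_trans lt_ik le_kl.
have ik : ~~ (i < k)%N by rewrite -leqNgt.
rewrite (bigD1 i) //= gC ?(negPf ik) // eqxx mul1r big1 ?addr0 // => l li.
by rewrite gC ?(negPf ik) // eq_sym (negPf li) mul0r.
Qed.

Lemma corner_mulmx_idr (D : 'M[F]_m.+1) g : g \in corner ->
  (forall i j, (j < k)%N -> D i j = 0) -> D *m GLmx g = D.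
Proof.
move=> /cornerP gC D0; apply/matrixP=> i j; rewrite mxE.
have [lt_jk|le_kj] := ltnP j k.
  rewrite D0 // big1 // => l _; have [lt_lk|le_kl] := ltnP l k; first by rewrite D0 ?mul0r.
  rewrite gC ?(ltnNge l) ?le_kl // -val_eqE /= gtn_eqF ?mulr0 //.
  exact: leq_trans lt_jk le_kl.
have jk : ~~ (j < k)%N by rewrite -leqNgt.
rewrite (bigD1 j) //= gC ?(negPf jk) ?andbF // eqxx mulr1 big1 ?addr0 // => l lj.
by rewrite gC ?(negPf jk) ?andbF // (negPf lj) mulr0.
Qed.

Lemma corner_normalises g h : g \in corner ->
  ((g^-1 * h * g)%g \in unitri F m k) = (h \in unitri F m k).
Proof.
suff conj g' h' : g' \in corner -> h' \in unitri F m k -> (g'^-1 * h' * g')%g \in unitri F m k.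
  move=> gC; apply/idP/idP => [|/conj]; last exact.
  by move/(conj g^-1%g); rewrite invgK -!mulgA mulKVg mulgV mulg1; apply; rewrite groupV.
move=> gC /unitriP hU; have gVC : g'^-1%g \in corner by rewrite groupV.
pose N := GLmx h' - 1%:M.
have N0 i j : ~~ ((i < j)%N && (k <= j)%N) -> N i j = 0.
  by move=> ij; rewrite /N 2!mxE hU // [in X in _ - X]mxE subrr.
have E : GLmx (g'^-1 * h' * g')%g = 1%:M + GLmx g'^-1%g *m N.
  have {1}-> : h' = mkGL (1%:M + N).
    by apply: GLmx_inj; rewrite mkGLE addrC subrK ?GLmx_unit.
  rewrite !GLmxM mkGLE; last by rewrite addrC subrK GLmx_unit.
  rewrite mulmxDr mulmx1 mulmxDl -GLmxM mulVg GLmx1 -mulmxA (corner_mulmx_idr gC) //.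
  by move=> i j jk; rewrite N0 // (leqNgt k) jk andbF.
apply/unitriP=> i j ij; rewrite E mxE [in X in X + _]mxE.
suff -> : (GLmx g'^-1%g *m N) i j = 0 by rewrite addr0.
rewrite mxE big1 // => l _; have [lj|/N0->] := boolP ((l < j)%N && (k <= j)%N); last by rewrite mulr0.
case/andP: lj => lt_lj le_kj; move: ij; rewrite le_kj andbT -leqNgt => le_ji.
rewrite (cornerP _ gVC) ?(ltnNge i) ?(leq_trans le_kj) //.
by rewrite -val_eqE /= gtn_eqF ?mul0r //; exact: leq_trans lt_lj le_ji.
Qed.

(** GL_k is transitive on nonzero row vectors.  A transvection clears all the entries
   of c but one, and a transposition moves the remaining one to the place p. *)
Lemma corner_row_reduction (c : 'rV[F]_m.+1) (p : 'I_m.+1) : (p < k)%N ->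
    (forall j, (k <= j)%N -> c 0 j = 0) ->
  exists g d, g \in corner /\ c *m GLmx g = d *: delta_mx 0 p.
Proof.
move=> pk c0; have [->|cn0] := eqVneq c 0.
  by exists 1%g, 0; rewrite group1 mul0mx scale0r.
have /existsP[i ci] : [exists i, c 0 i != 0].
  apply: contraNT cn0 => /existsPn c0'; apply/eqP/rowP=> i.
  by rewrite mxE; apply/eqP; have := c0' i; rewrite negbK.
have ik : (i < k)%N by rewrite ltnNge; apply: contraNN ci => /c0->.
(* r vanishes at i, so 1 - e r has inverse 1 + e r, and c (1 - e r) = c i e_i *)
pose r : 'rV[F]_m.+1 := (c 0 i)^-1 *: c - delta_mx 0 i.
have ri : r 0 i = 0 by rewrite !mxE !eqxx mulVf // subrr.
pose e : 'cV[F]_m.+1 := delta_mx i 0.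
have re : r *m e = 0.
  apply/matrixP=> a b; rewrite !ord1 !mxE (bigD1 i) //= ri mul0r add0r big1 // => l li.
  by rewrite !mxE (negPf li) mulr0.
have uT : 1%:M - e *m r \in unitmx.
  have : (1%:M - e *m r) *m (1%:M + e *m r) = 1%:M.
    rewrite mulmxDr mulmx1 mulmxBl mul1mx mulmxA -(mulmxA e r e) re mulmx0 mul0mx subr0.
    by rewrite subrK.
  by case/mulmx1_unit.
exists (mkGL (1%:M - e *m r) * perm_elt F (tperm i p))%g, (c 0 i).
have ce : c *m e = (c 0 i)%:M.
  by apply/matrixP=> a b; rewrite !ord1 -colE !mxE eqxx.
split.
  apply: groupM; apply/cornerP=> a b ab.
    rewrite mkGLE // mxE [in X in X + _]mxE [X in _ + X]mxE [X in _ - X]mxE big_ord1.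
    rewrite [e _ _]mxE andbT; case: (eqVneq a i) ab => [->|]; rewrite ?mul0r ?subr0 // ik /= -leqNgt.
    move=> le_kb; have ib : i != b by rewrite -val_eqE /= ltn_eqF // (leq_trans ik).
    by rewrite mul1r /r !mxE (c0 b) // mulr0 (eq_sym b) (negPf ib) andbF !subr0.
  rewrite perm_elt_coefE; case: tpermP => [Ea|Ea|//]; move: ab; rewrite Ea ?ik ?pk /= -leqNgt => le_kb.
    by rewrite -!val_eqE /= !ltn_eqF // (leq_trans _ le_kb).
  by rewrite -!val_eqE /= !ltn_eqF // (leq_trans _ le_kb).
rewrite GLmxM mkGLE // mulmxA mulmxBr mulmx1 mulmxA ce mul_scalar_mx.
rewrite scalerBr scalerA mulfV // scale1r opprB addrC subrK -scalemxAl perm_eltE.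
congr (_ *: _); apply/rowP=> b; rewrite -[tperm i p]invgK -col_permE !mxE !eqxx /=.
by rewrite tpermV (canF_eq (tpermK i p)) tpermL.
Qed.

End CornerGroup.

Section Generation.
Variables (R : idomainType) (F : finFieldType) (m : nat) (psi : F -> R).
Hypothesis psiP : additive_character psi.
Local Notation G := (GLn F m).
Local Notation RG := (group_algebra R G).
Local Notation delta := (@galg_elt R G).
Local Notation eps := (steinberg_gen R F m).
Local Notation scal := (@scal R G).
Local Notation whittaker := (@whittaker R F m psi).
Implicit Types (g h u v : G) (D : 'M[F]_m.+1) (x y : RG).

Lemma whittaker_conj k D D1 g :
    (forall h, ((g^-1 * h * g)%g \in unitri F m k) = (h \in unitri F m k)) ->
    (forall h, h \in unitri F m k -> \tr (D *m GLmx (g^-1 * h * g)%g) = \tr (D1 *m GLmx h)) ->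
  delta g * whittaker k D = whittaker k D1 * delta g.
Proof.
move=> gU gD; apply/ffunP=> h; rewrite galg_elt_mulE galg_mul_eltE !whittakerE.
have E : (g^-1 * h = g^-1 * (h * g^-1) * g)%g by rewrite mulgA mulgKV.
rewrite E gU; have [hU|_] := boolP (_ \in _); last by rewrite !mul0r.
by rewrite gD.
Qed.

(** Diagonal matrices permute the generic characters transitively, and they fix
   eps. *)
Lemma whittaker_torus D D' : generic_subdiag D -> generic_subdiag D' ->
  exists g, delta g * (whittaker 0 D * eps) = whittaker 0 D' * eps.
Proof.
move=> [sD nD] [sD' nD'].
(* the torus element has to multiply each entry of D by the ratio to that of D' *)
pose ratio (k : nat) := D' (inord k.+1) (inord k) / D (inord k.+1) (inord k).
pose d (i : 'I_m.+1) := \prod_(k < i) ratio k.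
have d_neq0 i : d i != 0.
  apply/prodf_neq0 => k _; have ltk : (k.+1 < m.+1)%N by have := ltn_ord i; have := ltn_ord k; lia.
  have E : (inord k.+1 : 'I_m.+1) = (inord k : 'I_m.+1).+1 :> nat by rewrite !inordK // ltnW.
  by rewrite mulf_neq0 ?invr_eq0 ?nD ?nD'.
have uT : diag_mx (\row_i d i) \in unitmx by apply: diag_unitmx => i; rewrite mxE.
pose g : G := mkGL (diag_mx (\row_i d i)).
have gE i j : GLmx g i j = d i *+ (i == j) by rewrite mkGLE // !mxE.
have conjE h (i j : 'I_m.+1) : d i * GLmx (g^-1 * h * g)%g i j = GLmx h i j * d j.
  have E : (g * (g^-1 * h * g) = h * g)%g by rewrite !mulgA mulgV mul1g.
  have /matrixP/(_ i j) := congr1 (@GLmx F m) E; rewrite (GLmxM g) (GLmxM h) [LHS]mxE [RHS]mxE.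
  rewrite (bigD1 i) //= big1 ?addr0 => [|k ki]; last by rewrite gE eq_sym (negPf ki) mul0r.
  rewrite gE eqxx mulr1n => ->; rewrite (bigD1 j) //= big1 ?addr0 => [|k kj]; first by rewrite gE eqxx mulr1n.
  by rewrite gE (negPf kj) mulr0.
exists g; rewrite mulrA (@whittaker_conj 0 D D') => [|h|h hU].
- rewrite -mulrA; congr (_ * _); apply: diag_steinberg => i j ij.
  by rewrite gE (negPf ij).
- apply/unitri0P/unitri0P => hU i j ji.
    apply: (mulIf (d_neq0 j)); rewrite -conjE hU //.
    by case: eqVneq => [->|_]; rewrite ?mulr1 ?mul1r ?mulr0 ?mul0r.
  apply: (mulfI (d_neq0 i)); rewrite conjE hU //.
  by case: eqVneq => [->|_]; rewrite ?mulr1 ?mul1r ?mulr0 ?mul0r.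
rewrite !mxtrace_mulE; apply: eq_bigr => i _; apply: eq_bigr => j _.
have [ij|ij] := eqVneq (i : nat) j.+1; last by rewrite sD // sD' // !mul0r.
apply: (mulfI (d_neq0 j)); rewrite mulrCA conjE.
have dS : d i = d j * (D' i j / D i j).
  have -> : d i = \prod_(k < j.+1) ratio k by rewrite /d ij.
  by rewrite big_ord_recr /= /d /ratio -ij !inord_val.
by rewrite dS; field; exact: nD.
Qed.

End Generation.

Section UnitriOrder.
Variables (F : finFieldType) (m p l : nat).
Hypothesis pF : p \in [pchar F].
Local Notation U := (unitri F m 0).

Lemma strict_upper_expE (N : 'M[F]_m.+1) r :
    (forall i j : 'I_m.+1, (j <= i)%N -> N i j = 0) ->
  forall i j : 'I_m.+1, (j < i + r)%N -> (N ^+ r) i j = 0.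
Proof.
move=> N0; elim: r => [|r IHr] i j.
  by rewrite addn0 expr0 => ji; rewrite mxE -val_eqE /= gtn_eqF.
move=> jir; rewrite exprS -mulmxE mxE big1 // => k _.
have [le_ki|lt_ik] := leqP k i; first by rewrite N0 ?mul0r.
by rewrite IHr ?mulr0 //; lia.
Qed.

(** In characteristic p, a unipotent matrix 1 + N satisfies
   (1 + N)^(p^k) = 1 + N^(p^k), which is 1 for k large; so U is a p-group. *)
Lemma coprime_unitri : prime l -> l != p -> coprime #|U| l.
Proof.
move=> l_pr lp; have p_pr := pcharf_prime pF.
rewrite coprime_sym prime_coprime //; apply/negP => /(Cauchy l_pr)[x xU ox].
have pM : p \in [pchar 'M[F]_m.+1].
  rewrite inE p_pr /=; apply/eqP.
  by rewrite -[_%:R](rmorph_nat (@scalar_mx F m.+1)) (pcharf0 pF) rmorph0.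
have GLmxX n : GLmx (x ^+ n)%g = GLmx x ^+ n.
  by elim: n => [|n IHn]; rewrite ?GLmx1 // expgS exprS GLmxM IHn.
pose N := GLmx x - 1%:M.
have frob k : GLmx x ^+ (p ^ k) = 1 + N ^+ (p ^ k).
  elim: k => [|k IHk]; first by rewrite expn0 !expr1 addrC subrK.
  rewrite expnSr exprM IHk exprM -!(pFrobenius_autE pM) pFrobenius_autD_comm.
    by rewrite pFrobenius_aut1.
  exact/commr_sym/commr1.
have Npow0 : N ^+ (p ^ m.+1) = 0.
  apply/matrixP=> i j; rewrite strict_upper_expE ?mxE //.
    move=> a b ba; rewrite /N 2!mxE (unitri0P _ xU) //.
    by rewrite [in X in _ - X]mxE subrr.
  have := ltn_expl m.+1 (prime_gt1 p_pr); have := ltn_ord j; lia.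
have : (x ^+ (p ^ m.+1) == 1)%g.
  by apply/eqP/GLmx_inj; rewrite GLmxX frob Npow0 addr0 GLmx1.
rewrite -order_dvdn ox Euclid_dvdX // dvdn_prime2 // => /andP[/eqP lp' _].
by rewrite lp' eqxx in lp.
Qed.

End UnitriOrder.

Section Mirabolic.
Variables (R : idomainType) (F : finFieldType) (m : nat) (psi : F -> R).
Hypothesis psiP : additive_character psi.
Local Notation G := (GLn F m).
Local Notation delta := (@galg_elt R G).
Local Notation scal := (@scal R G).
Local Notation whittaker := (@whittaker R F m psi).
Variables (D : 'M[F]_m.+1) (k : 'I_m.+1).
Hypothesis sD : subdiag D.

(** [add_row c] describes the characters of [unitri k] that extend the one of D on
   the columns beyond k: on column k they are given by the vector c, of which only
   the entries before k matter. *)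
Definition rows_below : 'M[F]_m.+1 := \matrix_(i, j) if (k < i)%N then D i j else 0.
Definition row_before (c : 'rV[F]_m.+1) : 'rV[F]_m.+1 := \row_j if (j < k)%N then c 0 j else 0.
Definition add_row c : 'M[F]_m.+1 := rows_below + delta_mx k 0 *m row_before c.

Lemma tr_add_row c (A : 'M[F]_m.+1) :
  \tr (add_row c *m A) = \tr (rows_below *m A) + (row_before c *m A) 0 k.
Proof.
rewrite mulmxDl raddfD /= -mulmxA; congr (_ + _); rewrite mxtrace_mulC.
by rewrite -colE trace_mx11 !mxE.
Qed.

(** Orthogonality of the characters of column k: their sum vanishes unless this
   column is trivial, which is what distinguishes [unitri k.+1] in [unitri k]. *)
Lemma sum_whittaker_add_row :
  \sum_c whittaker k (add_row c) = scal (#|F|%:R ^+ m.+1) * whittaker k.+1 D.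
Proof.
apply/ffunP=> h; rewrite sum_ffunE scalE whittakerE.
under eq_bigr do rewrite whittakerE.
rewrite -mulr_sumr; have [hU|hU] := boolP (h \in unitri F m k); last first.
  rewrite mul0r (_ : h \in unitri F m k.+1 = false) ?mul0r ?mulr0 //.
  apply: contraNF hU => /unitriP hU; apply/unitriP=> i j ij; apply: hU.
  by apply: contraNN ij => /andP[-> /ltnW].
rewrite mul1r; under eq_bigr do rewrite tr_add_row opprD (addcharD psiP).
rewrite -mulr_sumr.
have h_lower (i : 'I_m.+1) : (k <= i)%N -> GLmx h i k = (i == k)%:R.
  by move=> ki; rewrite (unitriP _ _ hU) // leqnn andbT -leqNgt.
have [hk|] := boolP [forall j : 'I_m.+1, (j < k)%N ==> (GLmx h j k == 0)]; last first.
  move/forallPn=> [j]; rewrite negb_imply => /andP[jk hj].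
  have [_ _ [t0 t0P]] := psiP.
  rewrite [X in _ * X](@sum_character_eq0 _ _ _ (- (t0 / GLmx h j k) *: delta_mx 0 j)).
  - rewrite mulr0 (_ : h \in unitri F m k.+1 = false) ?mul0r ?mulr0 //.
    apply: contraNF hj => /unitriP/(_ j k); rewrite ltnn andbF => /(_ isT)->.
    by rewrite -val_eqE /= ltn_eqF.
  - move=> c c' /=; rewrite -(addcharD psiP) -opprD; congr (psi (- _)).
    have -> : row_before (c + c') = row_before c + row_before c'.
      by apply/rowP=> i; rewrite !mxE; case: ifP; rewrite ?mxE ?addr0.
    by rewrite mulmxDl mxE.
  have -> : row_before (- (t0 / GLmx h j k) *: delta_mx 0 j) = - (t0 / GLmx h j k) *: delta_mx 0 j.
    apply/rowP=> i; rewrite !mxE eqxx /=; case: ifP => // ik.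
    by case: eqVneq ik => [->|_ _]; rewrite ?jk ?mulr0.
  rewrite -scalemxAl -rowE [X in psi (- X)]mxE [X in _ * X]mxE mulNr opprK divfK //.
have hU1 : h \in unitri F m k.+1.
  apply/unitriP=> i j; rewrite negb_and -leqNgt -ltnNge ltnS => ij.
  have [lt_ij|le_ji] := ltnP i j; last first.
    by rewrite (unitriP _ _ hU) // (ltnNge i) le_ji.
  rewrite leqNgt lt_ij /= in ij; rewrite -val_eqE /= ltn_eqF //.
  move: ij; rewrite leq_eqVlt => /orP[/eqP/val_inj jk|jk].
    by apply/eqP; rewrite jk; move/forallP/(_ i)/implyP: hk; apply; rewrite -jk.
  by rewrite (unitriP _ _ hU) ?(leqNgt k) ?jk ?andbF // -val_eqE /= ltn_eqF.
rewrite hU1 mul1r (eq_bigr (fun=> 1)) => [|c _]; last first.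
  rewrite -(addchar0 psiP); congr psi; apply/eqP; rewrite oppr_eq0; apply/eqP.
  rewrite mxE big1 // => j _; rewrite mxE; case: ifP => jk; last by rewrite mul0r.
  by move/forallP/(_ j)/implyP/(_ jk)/eqP: hk => ->; rewrite mulr0.
rewrite sumr_const card_mx mul1n -natrX mulrC; congr (_ * psi (- _)).
rewrite !mxtrace_mulE; apply: eq_bigr => i _; apply: eq_bigr => j _.
rewrite mxE; case: ltnP => // le_ik.
have [ij|ij] := eqVneq (i : nat) j.+1; last by rewrite sD // !mul0r.
have ji : (j < i)%N by rewrite ij.
by rewrite (unitriP _ _ hU1) ?ltnNge ?le_ik ?andbF // -val_eqE /= ltn_eqF // mul0r mulr0.
Qed.

Hypothesis k_gt0 : (0 < k)%N.

(** Conjugation by GL_k makes the vector on column k proportional to its last basis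
   vector, and then the character is again given by a subdiagonal matrix. *)
Lemma whittaker_add_row_conj c : exists g D2, subdiag D2 /\
  delta g * whittaker k D2 = whittaker k (add_row c) * delta g.
Proof.
have ltp : (k.-1 < m.+1)%N by apply: leq_ltn_trans (ltn_ord k); apply: leq_pred.
pose p := Ordinal ltp; have kp : k = p.+1 :> nat by rewrite /= prednK.
have [|j kj|g [d [gC cg]]] := @corner_row_reduction F m k (row_before c) p.
- by rewrite kp.
- by rewrite mxE ltnNge kj.
exists g, (rows_below + d *: delta_mx k p); split.
  move=> i j ij; rewrite !mxE sD // if_same add0r.
  case: andP => [[/eqP ik /eqP jp]|]; last by rewrite mulr0.
  by move: ij; rewrite ik jp kp eqxx.
apply: whittaker_conj => [h|h _]; first exact: corner_normalises.
have below_g : rows_below *m GLmx g = rows_below.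
  apply: corner_mulmx_idr gC _ => i j jk; rewrite mxE; case: ltnP => // ki.
  by apply: sD; lia.
have -> : rows_below + d *: delta_mx k p = add_row c *m GLmx g.
  rewrite mulmxDl below_g -mulmxA cg -scalemxAr; congr (_ + _ *: _).
  by rewrite mul_delta_mx.
rewrite -mulmxA -GLmxM !mulgA mulgV mul1g GLmxM mulmxA mxtrace_mulC mulmxA.
congr (\tr (_ *m _)); apply: corner_mulmx_id gC _ => i j ik.
rewrite !mxE ltnNge (ltnW ik) /= big1 ?addr0 // => a _.
by rewrite !mxE -val_eqE /= (ltn_eqF ik) /= mul0r.
Qed.

End Mirabolic.

Section InvertibleMod.
Variables (R : comPzRingType) (l : nat).

Definition invertible_mod (c : R) := exists d e, c * d = 1 + e *+ l.

Lemma invertible_modM c d : invertible_mod (c * d) -> invertible_mod c.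
Proof. by move=> [x [y E]]; exists (d * x), y; rewrite mulrA. Qed.

Lemma invertible_mod_nat k : coprime k l -> (0 < k)%N -> invertible_mod k%:R.
Proof.
move=> kl k0; have /coprimeP := kl => /(_ k0)[[u v] /= E].
exists u%:R, v%:R; rewrite -natrM -mulrnA -[X in X + _](mulr1n 1) -mulrnDr; congr (_%:R).
lia.
Qed.

End InvertibleMod.

Section Generation.
Variables (R : idomainType) (F : finFieldType) (m p l : nat) (psi : F -> R).
Hypotheses (psiP : additive_character psi) (pF : p \in [pchar F]).
Hypotheses (l_pr : prime l) (lp : l != p).
Local Notation G := (GLn F m).
Local Notation RG := (group_algebra R G).
Local Notation delta := (@galg_elt R G).
Local Notation eps := (steinberg_gen R F m).
Local Notation scal := (@scal R G).
Local Notation whittaker := (@whittaker R F m psi).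
Variable N : RG -> Prop.
Hypothesis N_add : forall x y, N x -> N y -> N (x + y).
Hypothesis N_mul : forall a x, N x -> N (a * x).
Hypothesis N_l : forall a, N (a * eps *+ l).

(** N contains l I, so scalars invertible modulo l can be cancelled in N. *)
Lemma submod_cancel c a : invertible_mod l c -> N (scal c * (a * eps)) -> N (a * eps).
Proof.
move=> [d [e E]] /(N_mul (scal d)); rewrite mulrA -scalM mulrC E scalD scal1 mulrDl mul1r.
have -> : scal (e *+ l) * (a * eps) = scal e * a * eps *+ l.
  by apply/ffunP=> g; rewrite scalE ffunMnE -mulrA scalE mulrnAl.
move/N_add => /(_ _ (N_mul (-1) (N_l (scal e * a)))).
by rewrite mulN1r addrK.
Qed.

Lemma submod_sum (I : finType) (f : I -> RG) : (forall i, N (f i)) -> N (\sum_i f i).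
Proof.
move=> fN; apply: (big_ind N) => // [].
by rewrite -(mul0r (0 * eps *+ l)); apply/N_mul/N_l.
Qed.

Lemma field_card_invertible n : invertible_mod l (#|F|%:R ^+ n : R).
Proof.
rewrite -natrX; apply: invertible_mod_nat; last by rewrite expn_gt0 (ltn_trans _ (finNzRing_gt1 F)).
rewrite coprimeXl // (card_pprimeChar pF) coprimeXl // coprime_sym.
by rewrite prime_coprime // dvdn_prime2 // (pcharf_prime pF).
Qed.

Theorem whittaker_generates D : generic_subdiag D -> N (whittaker 0 D * eps) -> forall a, N (a * eps).
Proof.
move=> gD ND.
have N_generic D' : generic_subdiag D' -> N (whittaker 0 D' * eps).
  by move=> gD'; have [g <-] := @whittaker_torus R F m psi D D' gD gD'; apply: N_mul.
have N0 D' : subdiag D' -> forall a, N (whittaker 0 D' * (a * eps)).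
  move=> sD' a; have [c ->] := whittaker_steinberg psiP a sD'; apply: N_mul.
  have [D2 [g [c' [d [gD2 E cd]]]]] := whittaker_degenerate psiP sD'.
  apply: (@submod_cancel c').
    apply: (@invertible_modM _ _ _ d); rewrite cd; apply: invertible_mod_nat.
      exact: (coprime_unitri m pF l_pr lp).
    exact: (@cardG_gt0 _ (unitri_group F m)).
  by rewrite -E; apply/N_mul/N_mul/N_generic.
have Nk k : (k <= m)%N -> forall D', subdiag D' -> forall a, N (whittaker k.+1 D' * (a * eps)).
  elim: k => [|k IHk] km D' sD' a.
    suff -> : whittaker 1 D' = whittaker 0 D' by exact: N0.
    apply/ffunP=> h; rewrite !whittakerE; congr ((_ : bool)%:R * _).
    by apply/unitriP/unitriP => hU i j ij; apply: hU; apply: contraNN ij; lia.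
  rewrite mulrA; apply: (@submod_cancel (#|F|%:R ^+ m.+1)); first exact: field_card_invertible.
  have ltk : (k.+1 < m.+1)%N by [].
  rewrite !mulrA -(@sum_whittaker_add_row R F m psi psiP D' (Ordinal ltk) sD') -mulrA mulr_suml.
  apply: submod_sum => c; have [g [D2 [sD2 E]]] := @whittaker_add_row_conj R F m psi D' (Ordinal ltk) sD' isT c.
  have -> : a * eps = delta g * (delta g^-1%g * a * eps).
    by rewrite !mulrA -galg_eltM mulgV galg_elt1 mul1r.
  by rewrite mulrA -E -mulrA; apply/N_mul/IHk => //; exact: ltnW.
move=> a; have s0 : subdiag (0 : 'M[F]_m.+1) by move=> i j _; rewrite mxE.
have := Nk m (leqnn m) 0 s0 a; suff -> : whittaker m.+1 0 = 1 by rewrite mul1r.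
apply/ffunP=> h; rewrite whittakerE mul0mx mxtrace0 oppr0 (addchar0 psiP) mulr1.
rewrite -galg_elt1 galg_eltE; congr ((_ : bool)%:R); apply/unitriP/eqP => [hU|-> i j _].
  apply/GLmx_inj/matrixP=> i j; rewrite GLmx1 mxE hU // negb_and -!ltnNge.
  by rewrite ltn_ord orbT.
by rewrite GLmx1 mxE.
Qed.

End Generation.

(** * The bilinear form and the irreducibility of the top factor *)

Section Form.
Variables (R : idomainType) (F : finFieldType) (m l : nat) (psi : F -> R).
Hypothesis psiP : additive_character psi.
Local Notation G := (GLn F m).
Local Notation RG := (group_algebra R G).
Local Notation B := (Borel F m).
Local Notation P := (@perm_elt F m).
Local Notation U := (unitri F m 0).
Local Notation delta := (@galg_elt R G).
Local Notation eps := (steinberg_gen R F m).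
Local Notation scal := (@scal R G).
Local Notation whittaker := (@whittaker R F m psi).
Implicit Types (D : 'M[F]_m.+1) (x y : RG).

Lemma galg_bformC x y : galg_bform x y = galg_bform y x.
Proof. by rewrite !galg_bformE; apply: eq_bigr => g _; rewrite mulrC. Qed.

Lemma galg_bformDl x y z : galg_bform (x + y) z = galg_bform x z + galg_bform y z.
Proof. by rewrite !galg_bformE -big_split; apply: eq_bigr => g _; rewrite galg_DE mulrDl. Qed.

Lemma galg_bformMnl x y k : galg_bform (x *+ k) y = galg_bform x y *+ k.
Proof. by rewrite !galg_bformE -sumrMnl; apply: eq_bigr => g _; rewrite ffunMnE mulrnAl. Qed.

Lemma galg_bform_scal c x y : galg_bform (scal c * x) y = c * galg_bform x y.
Proof. by rewrite !galg_bformE mulr_sumr; apply: eq_bigr => g _; rewrite scalE mulrA. Qed.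

Lemma gadjK : involutive (@gadj R F m).
Proof. by move=> a; apply/ffunP=> g; rewrite !gadjE invgK. Qed.

Lemma gadj_elt g : gadj (delta g) = delta g^-1%g.
Proof. apply/ffunP=> h; rewrite gadjE !galg_eltE. by rewrite (inv_eq invgK). Qed.

Lemma tr_oppmx D A : \tr (- D *m A) = - \tr (D *m A).
Proof. by rewrite !mxtrace_mulE -sumrN; apply: eq_bigr => i _; rewrite -sumrN;
  apply: eq_bigr => j _; rewrite mxE mulNr. Qed.

Lemma gadj_whittaker D : subdiag D -> gadj (whittaker 0 D) = whittaker 0 (- D).
Proof.
move=> sD; apply/ffunP=> h; rewrite gadjE !whittakerE groupV.
have [hU|_] := boolP (h \in U); last by rewrite !mul0r.
by rewrite subdiag_trV // tr_oppmx.
Qed.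

Lemma opp_subdiag D : generic_subdiag D -> generic_subdiag (- D).
Proof.
move=> [sD nD]; split=> i j ij; first by rewrite mxE sD ?oppr0.
by rewrite mxE oppr_eq0 nD.
Qed.

(** By adjunction the value is, up to sign, the sum of W_(-D) eps over the coset w0 B
   of the longest permutation, on which W_(-D) eps is constantly that sign. *)
Lemma galg_bform_whittaker D : generic_subdiag D -> galg_bform eps (whittaker 0 D * eps) = #|B|%:R.
Proof.
move=> gD; have [sD _] := gD; rewrite (whittaker_nondeg psiP gD) -scal_sign galg_bformC galg_bform_scal.
rewrite !galg_bform_adj gadj_whittaker // gadj_elt galg_bformE (bigID (mem B)) /=.
rewrite [X in _ + X]big1 ?addr0 => [|b bB]; last by rewrite galg_sum_coefE (negPf bB) mul0r.
rewrite (eq_bigr (fun=> (-1) ^+ rev_perm m)) => [|b bB].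
  by rewrite sumr_const mulrnAr -signr_addb addbb.
rewrite galg_sum_coefE bB mul1r galg_elt_mulE invgK -[P _]mul1g.
rewrite (whittaker_nondegE psiP (opp_subdiag gD)) // tr_oppmx opprK.
by rewrite subdiag_tr1 // (addchar0 psiP) mulr1.
Qed.

Section Submodule.
Variable N : RG -> Prop.
Hypothesis N_mul : forall a x, N x -> N (a * x).
Hypothesis N_eps : forall x, N x -> exists a, x = a * eps.

(** The y for which f (N, y) is divisible by l form a submodule containing l I.
   By adjunction it contains W_D eps for generic D, hence it is everything. *)
Lemma degenerate_in_radical (p : nat) : p \in [pchar F] -> prime l -> l != p ->
    (forall D x, generic_subdiag D -> N x -> exists a, whittaker 0 D * x = a * eps *+ l) ->
  forall x a, N x -> exists r, galg_bform x (a * eps) = r *+ l *+ #|B|.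
Proof.
move=> pF l_pr lp degN.
pose M y := forall x, N x -> exists r, galg_bform x y = r *+ l *+ #|B|.
pose D0 : 'M[F]_m.+1 := \matrix_(i, j) (i == j.+1 :> nat)%:R.
have gD0 : generic_subdiag D0.
  by split=> i j ij; rewrite mxE ?ij ?eqxx ?oner_eq0 // (negPf ij).
suff genM a : M (a * eps) by move=> x a Nx; apply: genM.
apply: (whittaker_generates psiP pF l_pr lp (N := M) _ _ _ gD0).
- move=> y z My Mz x Nx; have [[r Er] [s Es]] := (My x Nx, Mz x Nx).
  by exists (r + s); rewrite galg_bformC galg_bformDl galg_bformC Er galg_bformC Es !mulrnDl.
- move=> b y My x Nx; rewrite -[b]gadjK -galg_bform_adj; exact/My/N_mul.
- move=> b x /N_eps[c ->]; have [r E] := galg_bform_Borel c b.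
  by exists r; rewrite galg_bformC galg_bformMnl galg_bformC E mulrnAC.
move=> x Nx; rewrite -(opprK D0) -gadj_whittaker; last by case: (opp_subdiag gD0).
rewrite -galg_bform_adj; have [b ->] := degN _ _ (opp_subdiag gD0) Nx.
have [r E] := galg_bform_Borel b 1; exists r.
by rewrite galg_bformMnl -[eps in X in galg_bform _ X]mul1r E mulrnAC.
Qed.

End Submodule.
End Form.

End OpaqueGroup.

Section TopFactor.
Variables (R : idomainType) (F : finFieldType) (m l : nat).
Local Notation St := (steinberg R F m.+1).
Local Notation M0 := (layer_factor R F m.+1 l 0).
Local Notation piL := (\pi_(Quotient.quot (multiples St l))).
Local Notation piM := (\pi_(Quotient.quot (submodule_pred (@next_layer R F m.+1 l 0)))).

Definition to_layer0 (x : St) : submodule_type (@layer R F m.+1 l 0) :=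
  Submodule (layer0 (piL x)).

(** The quotient map of the lattice onto M(0) = L(0) / L(1). *)
Definition top_class (x : St) : M0 := piM (to_layer0 x).

Lemma top_classD x y : top_class (x + y) = top_class x + top_class y.
Proof.
rewrite -quotient_piD; congr piM; apply: val_inj; exact: reduction_piD.
Qed.

Lemma top_classZ a x : top_class (a *: x) = galg_reduce l a *: top_class x.
Proof.
transitivity (piM (galg_reduce l a *: to_layer0 x)); last first.
  exact (esym (@quotient_piZ _ _ (@next_layer R F m.+1 l 0) (galg_reduce l a) (to_layer0 x))).
congr piM; apply: val_inj; rewrite [RHS]linearZ.
exact/esym/reduction_piZ.
Qed.

Lemma top_class_surj z : exists x, z = top_class x.
Proof.
rewrite -[z]quotient_reprK; case: (repr z) => y y0; exists (repr y).
by congr piM; apply: val_inj => /=; rewrite reprK.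
Qed.

Lemma top_class_eq0 x : (top_class x == 0) = (piL x \in @layer R F m.+1 l 1).
Proof.
rewrite -[0](raddf0 piM) -Quotient.idealrBE subr0.
by [].
Qed.

Lemma top_class_l x : top_class (x *+ l) = 0.
Proof.
apply/eqP; rewrite top_class_eq0 (_ : piL _ = 0) ?rpred0 //.
apply/eqP; rewrite -[0](raddf0 piL) -Quotient.idealrBE subr0.
by apply/multiplesP; exists x.
Qed.

Lemma top_class_radical x : steinberg_layer l 1 x -> top_class x = 0.
Proof. by move=> x1; apply/eqP; rewrite top_class_eq0; apply/layerP; exists x. Qed.

Lemma top_class_eq0P x : top_class x = 0 ->
  exists u w : St, steinberg_layer l 1 u /\ x = u + w *+ l.
Proof.
move/eqP; rewrite top_class_eq0 => /layerP[u u1 /eqP].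
rewrite -Quotient.idealrBE => /multiplesP[w E]; exists u, w; split=> //.
by rewrite -E addrC subrK.
Qed.

End TopFactor.

Section FormDivisibility.
Variables (R : idomainType) (F : finFieldType) (m : nat).
Hypothesis R_char0 : [pchar R] =i pred0.
Local Notation St := (steinberg R F m.+1).
Local Notation RG := (group_algebra R (GLn F m)).
Local Notation eps := (steinberg_gen R F m).
Local Notation B := (Borel F m).

Definition steinberg_val (x : St) : RG := val x.

Lemma steinberg_mulE (a : RG) : steinberg_val (steinberg_mul a) = a * eps.
Proof. by []. Qed.

Lemma steinberg_val_inj : injective steinberg_val.
Proof. exact: val_inj. Qed.

Lemma steinberg_mulP x : exists a : RG, x = steinberg_mul a.
Proof.
by have /steinberg_idealP[a E] := valP x; exists a; apply: steinberg_val_inj.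
Qed.

Lemma char0_natr_neq0 k : (0 < k)%N -> k%:R != 0 :> R.
Proof. by rewrite (pcharf0P R).1 // -lt0n. Qed.

Lemma card_Borel_neq0 : #|B|%:R != 0 :> R.
Proof. by apply/char0_natr_neq0/(@cardG_gt0 _ (Borel_group F m)). Qed.

Lemma steinberg_formE x y r :
  galg_bform (steinberg_val x) (steinberg_val y) = r * #|B|%:R <-> steinberg_form x y = tofrac r.
Proof.
have B0 : tofrac (#|B|%:R : R) != 0 by rewrite tofrac_eq0 card_Borel_neq0.
have -> : steinberg_form x y =
    tofrac (galg_bform (steinberg_val x) (steinberg_val y)) / tofrac (#|B|%:R : R).
  by rewrite rmorph_nat.
split=> [->|/(canRL (divfK B0))]; first by rewrite rmorphM mulfK.
by rewrite -rmorphM => /eqP; rewrite tofrac_eq => /eqP.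
Qed.

End FormDivisibility.

Section Main.
Variables (R : idomainType) (F : finFieldType) (m p l : nat) (psi : F -> R).
Hypotheses (psiP : additive_character psi) (pF : p \in [pchar F]).
Hypotheses (l_pr : prime l) (lp : l != p).
Hypothesis R_char0 : [pchar R] =i pred0.
Hypothesis l_max : maximal_ideal (fun x : R => x \in multiples R l).
Local Notation St := (steinberg R F m.+1).
Local Notation eps := (steinberg_gen R F m).

(** R / l R is a field: the ideal generated by c and l is larger than l R. *)
Lemma invertible_mod_maximal c : c \notin multiples R l -> invertible_mod l c.
Proof.
move=> cl; have [[J0 JD JM] _ Jmax] := l_max.
have [||[d [e E]]|sub] := Jmax (fun x => exists d e, x = c * d + e *+ l).
- split=> [|x y [d [e ->]] [d' [e' ->]]|a x [d [e ->]]].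
  + by exists 0, 0; rewrite mulr0 mul0rn addr0.
  + by exists (d + d'), (e + e'); rewrite mulrDr mulrnDl addrACA.
  by exists (a * d), (a * e); rewrite mulrDr mulrCA mulrnAr.
- by move=> x /multiplesP[w ->]; exists 0, w; rewrite mulr0 add0r.
- by exists d, (- e); rewrite E mulNrn addrK.
by case/negP: cl; apply: sub; exists 1, 0; rewrite mulr1 mul0rn addr0.
Qed.

(** Otherwise eps would be in I(1) + l I, and f (eps, W_D eps) = 1 in l R. *)
Lemma top_class_neq0 : top_class l (steinberg_mul (1 : group_algebra R (GLn F m))) != 0.
Proof.
apply/eqP => /top_class_eq0P[u [w [u1 E]]].
pose D0 : 'M[F]_m.+1 := \matrix_(i, j) (i == j.+1 :> nat)%:R.
have gD0 : generic_subdiag D0.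
  by split=> i j ij; rewrite mxE ?ij ?eqxx ?oner_eq0 // (negPf ij).
pose W := whittaker psi 0 D0; have [_ l1 _] := l_max; apply: l1.
have [r /(steinberg_formE R_char0) Er] := u1 (steinberg_mul W).
have [b Eb] := steinberg_mulP w; have [s Es] := galg_bform_Borel b W.
apply/multiplesP; exists (r + s); apply: (mulIf (card_Borel_neq0 F m R_char0)).
have eps_uw : eps = steinberg_val u + b * eps *+ l.
  have : steinberg_val (steinberg_mul 1) = steinberg_val u + steinberg_val w *+ l.
    by rewrite E /steinberg_val raddfD raddfMn.
  by rewrite steinberg_mulE mul1r Eb steinberg_mulE.
have := galg_bform_whittaker psiP gD0; rewrite {1}eps_uw galg_bformDl galg_bformMnl Es Er expr1 => H.
by rewrite mul1r -{1}H; ring.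
Qed.

(** The preimage N of a submodule of M(0) contains l I.  It is all of I as soon as some
   W_D with D generic does not map it into l I, and lies in I(1) otherwise. *)
Lemma top_factor_irreducible : irreducible_module (layer_factor R F m.+1 l 0).
Proof.
split=> [|S]; first by eexists; exact: top_class_neq0.
pose N x := exists2 y : St, steinberg_val y = x & top_class l y \in S.
have N_add x y : N x -> N y -> N (x + y).
  by move=> [u <- uS] [v <- vS]; exists (u + v); rewrite // top_classD rpredD.
have N_mul a x : N x -> N (a * x).
  move=> [u <- uS]; exists (a *: u); first exact: steinberg_valZ.
  by rewrite top_classZ rpredZ.
have N_l a : N (a * eps *+ l).
  exists (steinberg_mul a *+ l); first by rewrite /steinberg_val raddfMn.
  by rewrite top_class_l rpred0.
have N_eps x : N x -> exists a, x = a * eps.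
  by move=> [u <- _]; have [a ->] := steinberg_mulP u; exists a.
have [[D [x [c [gD [Nx [E cl]]]]]]|degN] := pselect (exists D x c, generic_subdiag D /\
  N x /\ whittaker psi 0 D * x = scal _ c * (whittaker psi 0 D * eps) /\ c \notin multiples R l).
  right=> z; have [y ->] := top_class_surj z; have [a ->] := steinberg_mulP y.
  have ND : N (whittaker psi 0 D * eps).
    apply: (submod_cancel N_add N_mul N_l (invertible_mod_maximal cl)).
    by rewrite -E; apply: N_mul.
  have [u uE uS] := whittaker_generates psiP pF l_pr lp N_add N_mul N_l gD ND a.
  by have <- : u = steinberg_mul a by apply: steinberg_val_inj.
left=> z; have [x ->] := top_class_surj z => xS.
apply: top_class_radical => y; have [a ->] := steinberg_mulP y.
have divN D x' : generic_subdiag D -> N x' -> exists b, whittaker psi 0 D * x' = b * eps *+ l.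
  move=> gD Nx'; have [b xE] := N_eps _ Nx'.
  have [sD _] := gD; have [c cE] := whittaker_steinberg psiP b sD.
  have [/multiplesP[d dE]|cl] := boolP (c \in multiples R l); last first.
    by case: degN; exists D, x', c; do 3![split=> //]; rewrite xE.
  exists (scal _ d * whittaker psi 0 D); rewrite xE cE dE -mulrA.
  by apply/ffunP=> g; rewrite ffunMnE !scalE mulrnAl.
have Nx : N (steinberg_val x) by exists x.
have [r E] := @degenerate_in_radical R F m l psi psiP N N_mul N_eps p pF l_pr lp divN (steinberg_val x) a Nx.
exists r; apply/(steinberg_formE R_char0); rewrite E.
by rewrite expr1; ring.
Qed.

End Main.

Theorem theorem4p10 (n : nat) (hn : (2 <= n)%N)
    (F : finFieldType) (p : nat) (hp : p \in [pchar F])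
    (l : nat) (hl : prime l) (hlp : l != p)
    (R : idomainType) (hpid : pid R) (hchar : [pchar R] =i pred0)
    (hloc : local_with_maximal_ideal (fun x : R => x \in multiples R l))
    (hroot : exists z : R, p.-primitive_root z) :
  irreducible_module (layer_factor R F n l 0).
Proof.
case: n hn => // m _; have [z z_prim] := hroot.
have [psi psiP] := exists_additive_character hp z_prim.
exact: (top_factor_irreducible m psiP hp hl hlp hchar hloc.1).
Qed.
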